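(* If $\mathcal G$ and $\mathcal H$ are Morita equivalent topological groupoids, then $H_n(\mathcal G;A)\cong H_n(\mathcal H;A)$ and $H^n(\mathcal G;A)\cong H^n(\mathcal H;A)$ for every abelian group $A$ and every $n\ge0$.
   Context: Topological groupoid: spaces $\mathcal G_0,\mathcal G_1$, continuous $\mathrm{dom},\mathrm{cod}$, units, composition, inverse, $\mathrm{dom}$ open. A principal $\mathcal G$-bundle over a space $X$ is a space $E$ with continuous $p:E\to\mathcal G_0$, $w:E\to X$ and a continuous left $\mathcal G$-action w.r.t. $p$ with $w(g\cdot e)=w(e)$, $w$ an open surjection and $(g,e)\mapsto(g\cdot e,e)$ a homeomorphism $\mathcal G_1\times_{\mathcal G_0}E\to E\times_XE$; for continuous $f:Y\to X$ the pullback $f^*E=E\times_XY$ is a principal $\mathcal G$-bundle over $Y$. Let $\mathrm{HS}(X,\mathcal G)$ be the set of isomorphism classes of principal $\mathcal G$-bundles over $X$. With $\Delta^n$ the standard $n$-simplex and $d_i:\Delta^{n-1}\to\Delta^n$ the standard face maps, a singular $n$-simplex in $\mathcal G$ is an element of $\mathrm{HS}(\Delta^n,\mathcal G)$; $\mathfrak S_n(\mathcal G)$ is the free abelian group on $\mathrm{HS}(\Delta^n,\mathcal G)$ with boundary $\partial u=\sum_i(-1)^id_i^*u$. Then $H_n(\mathcal G;A)=H_n(\mathfrak S(\mathcal G)\otimes A)$ and $H^n(\mathcal G;A)=H^n(\mathrm{Hom}(\mathfrak S(\mathcal G),A))$. A continuous functor $\phi:\mathcal H\to\mathcal G$ is an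 essential equivalence if $\mathrm{cod}\circ\mathrm{pr}_1:\mathcal G_1\times_{\mathcal G_0}\mathcal H_0\to\mathcal G_0$ is an open surjection and $h\mapsto(\phi(h),\mathrm{dom}\,h,\mathrm{cod}\,h)$ is a homeomorphism $\mathcal H_1\to\mathcal G_1\times_{\mathcal G_0\times\mathcal G_0}(\mathcal H_0\times\mathcal H_0)$; Morita equivalence is the equivalence relation generated by essential equivalences. *)

(* Defs.v *)
From HB Require Import structures.
From mathcomp Require Import all_boot all_order all_algebra.
From mathcomp Require Import all_classical reals topology.
From mathcomp Require Import Rstruct Rstruct_topology.

Unset Implicit Arguments.
Unset Printing Implicit Defensive.

Import Order.TTheory GRing.Theory Num.Theory.
Local Open Scope classical_set_scope.
Local Open Scope ring_scope.

Notation Rl := Rdefinitions.R.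

(* General topology helpers.  Subspaces of a space X are represented by sets
   A : set X carrying the subspace topology; an open set of the subspace A is
   A `&` V with V open in X. *)

Definition open_map_on {X Y : topologicalType} (A : set X) (f : X -> Y) :=
  forall V : set X, open V -> open (f @` (A `&` V)).

Definition surj_on {X Y : Type} (A : set X) (f : X -> Y) :=
  forall y, exists2 x, A x & f x = y.

Definition homeo_on {X Y : topologicalType} (A : set X) (B : set Y)
    (f : X -> Y) :=
  exists g : Y -> X,
    [/\ (forall x, A x -> B (f x)) /\ (forall y, B y -> A (g y)),
        forall x, A x -> g (f x) = x,
        forall y, B y -> f (g y) = y &
        {within A, continuous f} /\ {within B, continuous g}].

(* Topological groupoids.  Convention: gcomp g h = g o h, defined when
   gdom g = gcod h. *)

Definition composable {O M : Type} (dom cod : M -> O) : set (M * M) :=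
  [set p | dom p.1 = cod p.2].

Definition groupoid_axioms {O M : topologicalType} (dom cod : M -> O)
    (unit : O -> M) (comp : M -> M -> M) (inv : M -> M) : Prop :=
  [/\ [/\ continuous dom, continuous cod, continuous unit, continuous inv &
          {within composable dom cod, continuous (fun p => comp p.1 p.2)}],
      [/\ forall x, dom (unit x) = x, forall x, cod (unit x) = x,
          forall g h, dom g = cod h -> dom (comp g h) = dom h &
          forall g h, dom g = cod h -> cod (comp g h) = cod g],
      [/\ forall f g h, dom f = cod g -> dom g = cod h ->
            comp f (comp g h) = comp (comp f g) h,
          forall g, comp (unit (cod g)) g = g &
          forall g, comp g (unit (dom g)) = g],
      [/\ forall g, dom (inv g) = cod g, forall g, cod (inv g) = dom g,
          forall g, comp (inv g) g = unit (dom g) &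
          forall g, comp g (inv g) = unit (cod g)] &
      open_map_on setT dom].

Record topgroupoid := TopGroupoid {
  gobj : topologicalType;
  garr : topologicalType;
  gdom : garr -> gobj;
  gcod : garr -> gobj;
  gunit : gobj -> garr;
  gcomp : garr -> garr -> garr;
  ginv : garr -> garr;
  gaxioms : groupoid_axioms gdom gcod gunit gcomp ginv }.
Arguments gdom {G} _ : rename.
Arguments gcod {G} _ : rename.
Arguments gunit {G} _ : rename.
Arguments gcomp {G} _ _ : rename.
Arguments ginv {G} _ : rename.

Record bundle (G : topgroupoid) (X : topologicalType) := Bundle {
  btot : topologicalType;
  bp : btot -> gobj G;
  bw : btot -> X;
  bact : garr G -> btot -> btot }.    (* (g, e) |-> g . e, for dom g = p e *)
Arguments btot {G X} E : rename.
Arguments bp {G X} E _ : rename.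
Arguments bw {G X} E _ : rename.
Arguments bact {G X} E _ _ : rename.

Definition act_dom {G : topgroupoid} {X : topologicalType} (E : bundle G X)
  : set (garr G * btot E) := [set q | gdom q.1 = bp E q.2].

Definition is_principal {G : topgroupoid} {X : topologicalType}
    (E : bundle G X) : Prop :=
  [/\ continuous (bp E) /\ continuous (bw E),
      {within act_dom E, continuous (fun q => bact E q.1 q.2)},
      [/\ forall g e, gdom g = bp E e -> bp E (bact E g e) = gcod g,
          forall e, bact E (gunit (bp E e)) e = e,
          forall g h e, gdom g = gcod h -> gdom h = bp E e ->
            bact E g (bact E h e) = bact E (gcomp g h) e &
          forall g e, gdom g = bp E e -> bw E (bact E g e) = bw E e],
      surj_on setT (bw E) /\ open_map_on setT (bw E) &
      homeo_on (act_dom E) [set q : btot E * btot E | bw E q.1 = bw E q.2]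
        (fun q => (bact E q.1 q.2, q.2))].

Definition bundle_iso {G : topgroupoid} {X : topologicalType}
    (E E' : bundle G X) : Prop :=
  exists phi : btot E -> btot E',
    [/\ homeo_on setT setT phi,
        forall e, bp E' (phi e) = bp E e,
        forall e, bw E' (phi e) = bw E e &
        forall g e, gdom g = bp E e -> phi (bact E g e) = bact E' g (phi e)].

Definition pb_set {G : topgroupoid} {X Y : topologicalType} (f : Y -> X)
    (E : bundle G X) : set (btot E * Y) := [set z | bw E z.1 = f z.2].

Definition pb_act {G : topgroupoid} {X Y : topologicalType} (f : Y -> X)
    (E : bundle G X) (g : garr G) (z : set_type (pb_set f E)) :
    set_type (pb_set f E) :=
  match pselect (pb_set f E (bact E g (val z).1, (val z).2)) with
  | left h => exist (fun x => x \in pb_set f E) _ (mem_set h)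
  | right _ => z  (* irrelevant: only used when gdom g = p z *)
  end.

Definition pullback {G : topgroupoid} {X Y : topologicalType} (f : Y -> X)
    (E : bundle G X) : bundle G Y :=
  @Bundle G Y (set_type (pb_set f E))
    (fun z => bp E (val z).1) (fun z => (val z).2) (pb_act f E).

Definition simplex_set (n : nat) : set 'rV[Rl]_n.+1 :=
  [set x | (forall i, 0 <= x 0 i) /\ \sum_i x 0 i = 1].

Definition simplex (n : nat) : topologicalType := set_type (simplex_set n).

Definition face_row {m : nat} (i : 'I_m.+2) (x : 'rV[Rl]_m.+1)
  : 'rV[Rl]_m.+2 :=
  \row_j (if unlift i j is Some k then x 0 k else 0).

Lemma face_rowP {m : nat} (i : 'I_m.+2) (x : simplex m) :
  face_row i (val x) \in simplex_set m.+1.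
Proof.
apply: mem_set; have [x0 x1] : simplex_set m (val x) := set_valP x.
split.
  by move=> j; rewrite mxE; case: unlift.
rewrite (bigD1_ord i) //= mxE unlift_none add0r -x1.
by apply: eq_bigr => k _; rewrite mxE liftK.
Qed.

Definition face {m : nat} (i : 'I_m.+2) (x : simplex m) : simplex m.+1 :=
  exist _ (face_row i (val x)) (face_rowP i x).

(* Singular chains with coefficients in A.
   A chain in S_n(G) (x) A is represented by a finite formal sum, i.e. a list
   of pairs (E, a) with E a principal G-bundle over Delta^n and a in A.
   Since S_n(G) is free abelian on HS(Delta^n, G), S_n(G) (x) A is the group of
   finitely supported functions HS(Delta^n,G) -> A; two lists represent the
   same element iff for every isomorphism class the coefficients sum up
   to the same value. *)

Definition chain (G : topgroupoid) (A : zmodType) (n : nat) :=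
  seq (bundle G (simplex n) * A).

Definition chain_wf {G : topgroupoid} {A : zmodType} {n : nat}
  (c : chain G A n) : Prop := forall p, List.In p c -> is_principal p.1.

Definition chain_equiv {G : topgroupoid} {A : zmodType} {n : nat}
    (c1 c2 : chain G A n) : Prop :=
  forall E : bundle G (simplex n), is_principal E ->
    \sum_(p <- c1 | `[< bundle_iso p.1 E >]) p.2 =
    \sum_(p <- c2 | `[< bundle_iso p.1 E >]) p.2.

Definition chain_add {G : topgroupoid} {A : zmodType} {n : nat}
  (c1 c2 : chain G A n) : chain G A n := c1 ++ c2.

Definition chain_opp {G : topgroupoid} {A : zmodType} {n : nat}
  (c : chain G A n) : chain G A n := [seq (p.1, - p.2) | p <- c].

Definition sgn_coef {A : zmodType} (i : nat) (a : A) : A :=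
  if odd i then - a else a.

Definition boundary {G : topgroupoid} {A : zmodType} {m : nat}
    (c : chain G A m.+1) : chain G A m :=
  flatten [seq [seq (pullback (face i) p.1, sgn_coef i p.2) | i <- enum 'I_m.+2]
          | p <- c].

Definition is_cycle {G : topgroupoid} {A : zmodType} {n : nat} :
    chain G A n -> Prop :=
  match n return chain G A n -> Prop with
  | 0 => fun c => chain_wf c
  | m.+1 => fun c => chain_wf c /\ chain_equiv (boundary c) [::]
  end.

Definition homologous {G : topgroupoid} {A : zmodType} {n : nat}
    (c1 c2 : chain G A n) : Prop :=
  exists2 d : chain G A n.+1, chain_wf d &
    chain_equiv (chain_add c1 (chain_opp c2)) (boundary d).

(* Singular cochains: Hom(S_n(G), A) = functions HS(Delta^n, G) -> A, i.e.
   functions on principal bundles over Delta^n that are invariant under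
   isomorphism (values on non-principal data are irrelevant). *)

Definition cochain (G : topgroupoid) (A : zmodType) (n : nat) :=
  bundle G (simplex n) -> A.

Definition cochain_wf {G : topgroupoid} {A : zmodType} {n : nat}
    (phi : cochain G A n) : Prop :=
  forall E E', is_principal E -> is_principal E' -> bundle_iso E E' ->
    phi E = phi E'.

Definition cochain_add {G : topgroupoid} {A : zmodType} {n : nat}
  (phi psi : cochain G A n) : cochain G A n := fun E => phi E + psi E.

Definition coboundary {G : topgroupoid} {A : zmodType} {m : nat}
    (phi : cochain G A m) : cochain G A m.+1 :=
  fun E => \sum_(i < m.+2) sgn_coef i (phi (pullback (face i) E)).

Definition is_cocycle {G : topgroupoid} {A : zmodType} {n : nat}
    (phi : cochain G A n) : Prop :=
  cochain_wf phi /\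
  forall E, is_principal E -> coboundary phi E = 0.

Definition cohomologous {G : topgroupoid} {A : zmodType} {n : nat} :
    cochain G A n -> cochain G A n -> Prop :=
  match n return cochain G A n -> cochain G A n -> Prop with
  | 0 => fun phi psi => forall E, is_principal E -> phi E = psi E
  | m.+1 => fun phi psi => exists2 chi : cochain G A m, cochain_wf chi &
      forall E, is_principal E -> phi E - psi E = coboundary chi E
  end.

(* Isomorphism of abelian groups presented as subquotients: Z1/~1 and Z2/~2,
   where Z is a set of representatives (cycles) closed under add and ~ is the
   relation "same class".  An isomorphism Z1/~1 ~= Z2/~2 is given by a map of
   representatives that is well defined and injective on classes, additive on
   classes, and surjective on classes. *)

Definition subquot_iso {T1 T2 : Type}
    (add1 : T1 -> T1 -> T1) (Z1 : T1 -> Prop) (R1 : T1 -> T1 -> Prop)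
    (add2 : T2 -> T2 -> T2) (Z2 : T2 -> Prop) (R2 : T2 -> T2 -> Prop) :=
  exists f : T1 -> T2,
    [/\ forall x, Z1 x -> Z2 (f x),
        forall x y, Z1 x -> Z1 y -> (R1 x y <-> R2 (f x) (f y)),
        forall x y, Z1 x -> Z1 y -> R2 (f (add1 x y)) (add2 (f x) (f y)) &
        forall y, Z2 y -> exists2 x, Z1 x & R2 (f x) y].

Definition homology_iso (G H : topgroupoid) (A : zmodType) (n : nat) :=
  subquot_iso (@chain_add G A n) (@is_cycle G A n) (@homologous G A n)
              (@chain_add H A n) (@is_cycle H A n) (@homologous H A n).

Definition cohomology_iso (G H : topgroupoid) (A : zmodType) (n : nat) :=
  subquot_iso (@cochain_add G A n) (@is_cocycle G A n) (@cohomologous G A n)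
              (@cochain_add H A n) (@is_cocycle H A n) (@cohomologous H A n).

Record gfunctor (H G : topgroupoid) := GFunctor {
  fobj : gobj H -> gobj G;
  farr : garr H -> garr G }.
Arguments fobj {H G} F _ : rename.
Arguments farr {H G} F _ : rename.

Definition is_cont_functor {H G : topgroupoid} (F : gfunctor H G) : Prop :=
  [/\ continuous (fobj F) /\ continuous (farr F),
      forall h, gdom (farr F h) = fobj F (gdom h),
      forall h, gcod (farr F h) = fobj F (gcod h),
      forall x, farr F (gunit x) = gunit (fobj F x) &
      forall h k, gdom h = gcod k ->
        farr F (gcomp h k) = gcomp (farr F h) (farr F k)].

Definition essential_equiv {H G : topgroupoid} (F : gfunctor H G) : Prop :=
  [/\ is_cont_functor F,
      let P := [set q : garr G * gobj H | gdom q.1 = fobj F q.2] in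
      surj_on P (fun q => gcod q.1) /\ open_map_on P (fun q => gcod q.1) &
      homeo_on setT
        [set t : garr G * (gobj H * gobj H) |
           gdom t.1 = fobj F t.2.1 /\ gcod t.1 = fobj F t.2.2]
        (fun h => (farr F h, (gdom h, gcod h)))].

Inductive morita_equiv : topgroupoid -> topgroupoid -> Prop :=
  | morita_ess H G (F : gfunctor H G) :
      essential_equiv F -> morita_equiv H G
  | morita_refl G : morita_equiv G G
  | morita_sym G H : morita_equiv G H -> morita_equiv H G
  | morita_trans G H K :
      morita_equiv G H -> morita_equiv H K -> morita_equiv G K.

(* Main.v *)
Require Import Defs.
From mathcomp Require Import all_boot all_algebra all_classical topology.
From mathcomp Require Import Rstruct Rstruct_topology.

(** An essential equivalence [F : H -> G] turns a principal [G]-bundle [E] into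
    the principal [H]-bundle [E x_{G_0} H_0].  This operation commutes with
    pullback along maps of base spaces, and it is a bijection on isomorphism
    classes: a map between induced bundles descends along the open surjection
    [(g, (e, y)) |-> g . e], and a principal [H]-bundle [B] is induced by the
    quotient of [G_1 x_{G_0} B] under [(g . F h, b) ~ (g, h . b)].  Hence
    Morita equivalent groupoids have naturally bijective sets [HS(X, -)], so
    their singular (co)chain complexes are isomorphic. *)

Import GRing.Theory.
Local Open Scope classical_set_scope.

(** * Open maps and continuity on subsets *)

(** Openness of maps carries the argument. A map on a fibre product of quotients is continuous if it
    can be descended along products and base changes of the quotient map; these need not be quotient
    maps in general, whereas open surjections are stable under both. Hence each cover used below,
    [spread] over [E] or the class map [pi], is shown to be open. The homeomorphism clause of
    principality is traded for a continuous division map sending [(e, e')] to the arrow [g] with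
    [g . e' = e]; a new bundle is shown principal by writing its division map down. A continuous
    equivariant map over the base between principal bundles is automatically an isomorphism, so each
    comparison needs a map in one direction only, and that direction can be the one that requires no
    choice of representatives. The preimage of an [H]-bundle is determined only up to isomorphism.
    The inverse bijection is therefore picked by choice, and its compatibility with isomorphisms and
    faces has to be deduced from the fact that induction reflects isomorphisms. *)

Definition cont_in {X Y : topologicalType} (A : set X) (f : X -> Y) :=
  forall x, A x -> forall V, nbhs (f x) V -> nbhs x [set y | A y -> V (f y)].

(** Openness between the subspaces [A] and [B], stated pointwise; for [B = setT] it is
    [open_map_on]. The relative target serves maps onto fibre products, which need not be open in
    the ambient product. *)
Definition open_on {X Y : topologicalType} (A : set X) (B : set Y)
    (q : X -> Y) :=
  forall x, A x -> forall V, nbhs x V ->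
    nbhs (q x) [set y | B y -> (q @` (A `&` V)) y].

Lemma cont_inP {X Y : topologicalType} (A : set X) (f : X -> Y) :
  {within A, continuous f} <-> cont_in A f.
Proof. exact: subspace_continuousP. Qed.

Lemma cont_inT {X Y : topologicalType} (f : X -> Y) :
  continuous f <-> cont_in setT f.
Proof.
split=> [cf x _ V nV|cf x V nV].
  by apply: filterS (cf x V nV : nbhs x (f @^-1` V)) => y h _.
have : nbhs x (f @^-1` V); last by [].
by apply: filterS (cf x Logic.I V nV) => y; exact.
Qed.

Section Continuity.
Context {X Y Z : topologicalType}.
Implicit Types (A : set X) (f : X -> Y).

Lemma cont_in_eq A f g :
  (forall x, A x -> f x = g x) -> cont_in A f -> cont_in A g.
Proof.
move=> fg cf x Ax V; rewrite -(fg x Ax) => /(cf x Ax).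
by apply: filterS => y h Ay; rewrite -(fg y Ay); exact: h.
Qed.

Lemma cont_in_comp A (B : set Y) (g : Y -> Z) f :
  (forall x, A x -> B (f x)) -> cont_in A f -> cont_in B g ->
  cont_in A (fun x => g (f x)).
Proof.
move=> AB cf cg x Ax V /(cg _ (AB _ Ax)) /= /(cf _ Ax).
by apply: filterS => y h /[dup] Ay /h; apply; exact: AB.
Qed.

Lemma cont_in_compT A (g : Y -> Z) f :
  continuous g -> cont_in A f -> cont_in A (fun x => g (f x)).
Proof. by move=> /cont_inT cg cf; exact: (@cont_in_comp _ setT). Qed.

Lemma cont_in_pair A f (g : X -> Z) :
  cont_in A f -> cont_in A g -> cont_in A (fun x => (f x, g x)).
Proof.
move=> cf cg x Ax V [[V1 V2] /= [/(cf x Ax) n1 /(cg x Ax) n2] VV].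
apply: filterS2 n1 n2 => y h1 h2 Ay.
by apply: VV; split => /=; [exact: h1|exact: h2].
Qed.

Lemma open_onT A f : open_map_on A f <-> open_on A setT f.
Proof.
split=> [fo a Aa V|fo V oV].
  rewrite nbhsE => -[U [oU Ua] UV].
  rewrite nbhsE /=; exists (f @` (A `&` U)).
    by split; [exact: fo|exists a].
  by move=> _ [b [Ab /UV Vb] <-] _; exists b.
rewrite openE => _ [a [Aa Va] <-].
have := fo a Aa V (open_nbhs_nbhs (conj oV Va)).
by apply: filterS => y; apply.
Qed.

Lemma open_on_eq A (B : set Y) f g :
  (forall x, A x -> f x = g x) -> open_on A B f -> open_on A B g.
Proof.
move=> fg fo a Aa V /(fo a Aa); rewrite (fg a Aa).
apply: filterS => y h /h [b [Ab Vb] <-].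
by exists b => //; rewrite fg.
Qed.

(** A point of [A] lying over [B'] is already in the restricted domain, so no image is lost. This
    passes from a product of open maps to its restriction over a fibre product. *)
Lemma open_on_restr A (B B' : set Y) f : B' `<=` B ->
  open_on A B f -> open_on [set x | A x /\ B' (f x)] B' f.
Proof.
move=> BB fo a [Aa Ba] V /(fo a Aa).
apply: filterS => y h /[dup] B'y /BB /h [b [Ab Vb] e].
by exists b => //; split => //; split => //; rewrite e.
Qed.

Lemma open_on_comp A (B : set Y) (C : set Z) f g :
  (forall x, A x -> B (f x)) ->
  open_on A B f -> open_on B C g -> open_on A C (fun x => g (f x)).
Proof.
move=> AB fo go a Aa V /(fo a Aa) h.
have /= := go _ (AB _ Aa) _ h.
apply: filterS => z k /k [y [By /(_ By) [x [Ax Vx] <-]] <-].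
by exists x.
Qed.

(** The [q]-image of [V] contains the image under [q o r] of the preimage of [V]. Thus openness of
    [q] can be tested on a continuous cover [r], which need not itself be open. *)
Lemma open_on_cancel A (B : set Y) (C : set Z) (r : X -> Y) (q : Y -> Z) :
  (forall x, A x -> B (r x)) -> (forall y, B y -> exists2 x, A x & r x = y) ->
  cont_in A r -> open_on A C (fun x => q (r x)) -> open_on B C q.
Proof.
move=> AB BA cr qo b /BA [a Aa <-] V /(cr a Aa) /= h.
have := qo a Aa _ h.
apply: filterS => z k /k [x [Ax /(_ Ax) Vx] <-].
by exists (r x) => //; split => //; exact: AB.
Qed.

(** An open surjection has the quotient property: the image of a neighbourhood on which [f o q]
    stays in [V] is a neighbourhood on which [f] does. *)
Lemma cont_in_descend A (B : set Y) (q : X -> Y) (f : Y -> Z) :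
  (forall x, A x -> B (q x)) -> (forall y, B y -> exists2 x, A x & q x = y) ->
  open_on A B q -> cont_in A (fun x => f (q x)) -> cont_in B f.
Proof.
move=> AB BA qo cf b /BA [a Aa <-] V /(cf a Aa) /= h.
have := qo a Aa _ h.
by apply: filterS => y k /k [x [Ax /(_ Ax) Vx] <-].
Qed.

(** Base change along [k]: if [z] is near [c], then [k z] is near [k c = q a], hence has a preimage
    under [q] near [a]. *)
Lemma open_on_pullback A (B : set Y) (C : set Z) q (k : Z -> Y) :
  (forall z, C z -> B (k z)) -> open_on A B q -> cont_in C k ->
  open_on [set p : X * Z | [/\ A p.1, C p.2 & q p.1 = k p.2]] C snd.
Proof.
move=> CB qo ck [a c] [/= Aa Cc e] V [[V1 V2] /= [n1 n2] VV].
have := qo a Aa V1 n1; rewrite e => /(ck c Cc) /= h.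
near=> z => Cz.
have [|x [Ax Vx] ex] := (near h z _ Cz (CB z Cz)) => //.
exists (x, z) => //; split => //; apply: VV; split => //=.
by near: z.
Unshelve. all: by end_near.
Qed.

End Continuity.

(** The stability that general quotient maps lack; it permits descent along [id x pi] and
    [pi x pi]. *)
Lemma open_on_prod {X Y X' Y' : topologicalType} (A : set X) (B : set Y)
    (A' : set X') (B' : set Y') (f : X -> Y) (f' : X' -> Y') :
  open_on A B f -> open_on A' B' f' ->
  open_on [set p | A p.1 /\ A' p.2] [set p | B p.1 /\ B' p.2]
    (fun p => (f p.1, f' p.2)).
Proof.
move=> fo fo' [a a'] [/= Aa Aa'] V [[V1 V2] /= [n1 n2] VV].
exists ([set y | B y -> (f @` (A `&` V1)) y],
        [set y | B' y -> (f' @` (A' `&` V2)) y]) => /=.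
  by split; [exact: fo|exact: fo'].
move=> [y y'] /= [h h'] [/h [x [Ax Vx] <-] /h' [x' [Ax' Vx'] <-]].
by exists (x, x') => //; split => //; exact: VV.
Qed.

Lemma open_on_id {X : topologicalType} (A : set X) : open_on A A id.
Proof.
move=> a Aa V n.
by apply: filterS n => x Vx Ax; exists x.
Qed.

Lemma cont_in_id {X : topologicalType} (A : set X) : cont_in A id.
Proof. by move=> x _ V nV; apply: filterS nV => y h _. Qed.

Lemma cont_in_fst {X Y Z : topologicalType} (A : set X) (f : X -> Y * Z) :
  cont_in A f -> cont_in A (fun x => (f x).1).
Proof. by apply: cont_in_compT => x; exact: cvg_fst. Qed.

Lemma cont_in_snd {X Y Z : topologicalType} (A : set X) (f : X -> Y * Z) :
  cont_in A f -> cont_in A (fun x => (f x).2).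
Proof. by apply: cont_in_compT => x; exact: cvg_snd. Qed.

(** * Subspaces as types, and quotient spaces *)

Section Subtypes.
Context {X Y : topologicalType} (S : set X).

Lemma val_cont : continuous (val : set_type S -> X).
Proof. exact: initial_continuous. Qed.

Lemma nbhs_set_type (z : set_type S) V :
  nbhs z V -> exists2 U, nbhs (val z) U & forall y, U (val y) -> V y.
Proof.
rewrite nbhsE => -[W [[U oU UW] Wz] WV]; exists U.
  by move: Wz; rewrite -UW => Uz; exists U.
by move=> y Uy; apply: WV; rewrite -UW.
Qed.

Lemma cont_in_val (A : set Y) (f : Y -> set_type S) :
  cont_in A (fun y => val (f y)) -> cont_in A f.
Proof.
move=> cf y Ay V /nbhs_set_type [U /(cf y Ay) n UV] /=; move: n.
by apply: filterS => x h /h /UV.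
Qed.

Lemma open_on_val : open_on setT S (val : set_type S -> X).
Proof.
move=> z _ V /nbhs_set_type [U n UV].
apply: filterS n => x Ux Sx.
by exists (exist _ x (mem_set Sx)) => //; split => //; exact: UV.
Qed.

End Subtypes.

Definition to_set_type {T : Type} (S : set T) (x : T) (Sx : S x) :
  set_type S := exist _ x (mem_set Sx).
Arguments to_set_type {T S x} Sx.

(* [z] is the junk value taken when [x] is outside [S]. *)
Definition insubd_set {T : Type} (S : set T) (z : set_type S) (x : T) :
    set_type S :=
  match pselect (S x) with
  | left Sx => to_set_type Sx
  | right _ => z
  end.
Arguments insubd_set {T S} z x.

Lemma val_insubd_set {T : Type} (S : set T) (z : set_type S) x :
  S x -> val (insubd_set z x) = x.
Proof. by rewrite /insubd_set; case: pselect. Qed.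

Lemma quotient_space {T : topologicalType} (r : T -> T -> Prop) :
  (forall x, r x x) -> (forall x y, r x y -> r y x) ->
  (forall x y z, r x y -> r y z -> r x z) ->
  exists (Q : topologicalType) (pi : T -> Q),
    [/\ continuous pi, forall q, exists x, pi x = q,
        forall x y, pi x = pi y <-> r x y &
        forall U, open (pi @^-1` U) -> open U].
Proof.
move=> rr rs rt; pose e : rel T := fun x y => `[< r x y >].
have er : reflexive e by move=> x; apply/asboolP.
have es : symmetric e by move=> x y; apply/asboolP/asboolP; exact: rs.
have et : transitive e.
  by move=> y x z /asboolP xy /asboolP yz; apply/asboolP; exact: rt yz.
pose e' := EquivRel e er es et.
exists (quotient_topology {eq_quot e'}%qT), (\pi_({eq_quot e'}))%qT; split.
- exact: (@pi_continuous _ {eq_quot e'}%qT).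
- by move=> q; exists (repr q); exact: reprK.
- by move=> x y; split=> [/eqmodP/asboolP|xy]; last exact/eqmodP/asboolP.
by [].
Qed.

(** * Principal bundles *)

Section Groupoid.
Context {G : topgroupoid}.
Implicit Types g h k : garr G.

Lemma gcod_cont : continuous (@gcod G).
Proof. by have [[]] := gaxioms G. Qed.

Lemma gunit_cont : continuous (@gunit G).
Proof. by have [[]] := gaxioms G. Qed.

Lemma ginv_cont : continuous (@ginv G).
Proof. by have [[]] := gaxioms G. Qed.

Lemma gcomp_cont {X : topologicalType} (A : set X) (g h : X -> garr G) :
  (forall x, A x -> gdom (g x) = gcod (h x)) ->
  cont_in A g -> cont_in A h -> cont_in A (fun x => gcomp (g x) (h x)).
Proof.
have [[_ _ _ _ /cont_inP mc]] := gaxioms G => _ _ _ _ gh cg ch.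
exact: (cont_in_comp _ _ _ _ gh (cont_in_pair _ _ _ cg ch) mc).
Qed.

Lemma gdom_open : open_on setT setT (@gdom G).
Proof. by apply/open_onT; have [] := gaxioms G. Qed.

Lemma gdom1 (x : gobj G) : gdom (gunit x) = x.
Proof. by have [_ []] := gaxioms G. Qed.

Lemma gcod1 (x : gobj G) : gcod (gunit x) = x.
Proof. by have [_ []] := gaxioms G. Qed.

Lemma gdomM g h : gdom g = gcod h -> gdom (gcomp g h) = gdom h.
Proof. by have [_ [_ _ + _] _ _ _] := gaxioms G; apply. Qed.

Lemma gcodM g h : gdom g = gcod h -> gcod (gcomp g h) = gcod g.
Proof. by have [_ [_ _ _ +] _ _ _] := gaxioms G; apply. Qed.

Lemma gcompA g h k : gdom g = gcod h -> gdom h = gcod k ->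
  gcomp g (gcomp h k) = gcomp (gcomp g h) k.
Proof. by have [_ _ [+ _ _] _ _] := gaxioms G; apply. Qed.

Lemma gcomp1g g : gcomp (gunit (gcod g)) g = g.
Proof. by have [_ _ []] := gaxioms G. Qed.

Lemma gcompg1 g : gcomp g (gunit (gdom g)) = g.
Proof. by have [_ _ []] := gaxioms G. Qed.

Lemma gdomV g : gdom (ginv g) = gcod g.
Proof. by have [_ _ _ []] := gaxioms G. Qed.

Lemma gcodV g : gcod (ginv g) = gdom g.
Proof. by have [_ _ _ []] := gaxioms G. Qed.

Lemma gcompVg g : gcomp (ginv g) g = gunit (gdom g).
Proof. by have [_ _ _ []] := gaxioms G. Qed.

Lemma gcompgV g : gcomp g (ginv g) = gunit (gcod g).
Proof. by have [_ _ _ []] := gaxioms G. Qed.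

Lemma gcompKV g h : gdom g = gcod h -> gcomp (ginv g) (gcomp g h) = h.
Proof.
by move=> e; rewrite gcompA ?gdomV // gcompVg e gcomp1g.
Qed.

Lemma gcompVK g h : gcod g = gcod h -> gcomp g (gcomp (ginv g) h) = h.
Proof.
by move=> e; rewrite gcompA ?gcodV ?gdomV // gcompgV e gcomp1g.
Qed.

Lemma gcompMV g h : gdom g = gcod h -> gcomp (gcomp g h) (ginv h) = g.
Proof.
by move=> e; rewrite -gcompA ?gcodV // gcompgV -e gcompg1.
Qed.

End Groupoid.

(** [d e e'] is the first component of the inverse of the shear map [(g, e) |-> (g . e, e)], with
    arbitrary values on pairs in different fibres. The last clause contains the freeness of the
    action. *)
Definition is_division {G : topgroupoid} {X : topologicalType}
    (E : bundle G X) (d : btot E -> btot E -> garr G) : Prop :=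
  [/\ cont_in [set q : btot E * btot E | bw E q.1 = bw E q.2]
        (fun q => d q.1 q.2),
      forall e e', bw E e = bw E e' -> gdom (d e e') = bp E e',
      forall e e', bw E e = bw E e' -> bact E (d e e') e' = e &
      forall g e, gdom g = bp E e -> d (bact E g e) e = g].

Section Principal.
Context {G : topgroupoid} {X : topologicalType} (E : bundle G X).

Lemma principal_intro (d : btot E -> btot E -> garr G) :
  continuous (bp E) -> continuous (bw E) ->
  cont_in (act_dom E) (fun q => bact E q.1 q.2) ->
  [/\ forall g e, gdom g = bp E e -> bp E (bact E g e) = gcod g,
      forall e, bact E (gunit (bp E e)) e = e,
      forall g h e, gdom g = gcod h -> gdom h = bp E e ->
        bact E g (bact E h e) = bact E (gcomp g h) e &
      forall g e, gdom g = bp E e -> bw E (bact E g e) = bw E e] ->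
  (forall x, exists e, bw E e = x) -> open_on setT setT (bw E) ->
  is_division E d -> is_principal E.
Proof.
move=> cp cw ca al ws wo [dc dd da ad]; split => //.
- exact/cont_inP.
- split; last exact/open_onT.
  by move=> x; have [e <-] := ws x; exists e.
exists (fun q => (d q.1 q.2, q.2)); case: al => _ _ _ aw; split.
- by split=> -[a e] /= h; rewrite /act_dom /=; [exact: aw|exact: dd].
- by move=> [g e] /= h; rewrite ad.
- by move=> [g e] /= h; rewrite da.
split; apply/cont_inP; apply: cont_in_pair => //;
  exact: cont_in_snd (cont_in_id _).
Qed.

Context (pE : is_principal E).

Lemma bp_cont : continuous (bp E). Proof. by have [[]] := pE. Qed.

Lemma bw_cont : continuous (bw E). Proof. by have [[]] := pE. Qed.

Lemma bact_cont {Y : topologicalType} (A : set Y) (g : Y -> garr G)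
    (e : Y -> btot E) : (forall y, A y -> gdom (g y) = bp E (e y)) ->
  cont_in A g -> cont_in A e -> cont_in A (fun y => bact E (g y) (e y)).
Proof.
have [_ /cont_inP ac _ _ _] := pE => ge cg ce.
exact: (cont_in_comp _ _ _ _ ge (cont_in_pair _ _ _ cg ce) ac).
Qed.

Lemma bpM g e : gdom g = bp E e -> bp E (bact E g e) = gcod g.
Proof. by have [_ _ [+ _ _ _] _ _] := pE; apply. Qed.

Lemma bact1 e : bact E (gunit (bp E e)) e = e.
Proof. by have [_ _ []] := pE. Qed.

Lemma bactA g h e : gdom g = gcod h -> gdom h = bp E e ->
  bact E g (bact E h e) = bact E (gcomp g h) e.
Proof. by have [_ _ [_ _ + _] _ _] := pE; apply. Qed.

Lemma bwM g e : gdom g = bp E e -> bw E (bact E g e) = bw E e.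
Proof. by have [_ _ [_ _ _ +] _ _] := pE; apply. Qed.

Lemma bactK g e : gdom g = bp E e -> bact E (ginv g) (bact E g e) = e.
Proof. by move=> h; rewrite bactA ?gdomV // gcompVg h bact1. Qed.

Lemma bactVK g e : gcod g = bp E e -> bact E g (bact E (ginv g) e) = e.
Proof. by move=> h; rewrite bactA ?gcodV ?gdomV // gcompgV h bact1. Qed.

Lemma bw_surj x : exists e, bw E e = x.
Proof. by have [_ _ _ [ws _] _] := pE; have [e _ <-] := ws x; exists e. Qed.

Lemma bw_open : open_on setT setT (bw E).
Proof. by have [_ _ _ [_ /open_onT]] := pE. Qed.

Lemma principal_division : exists d, is_division E d.
Proof.
have [_ _ _ _ [d [[_ dA] ad da [_ /cont_inP dc]]]] := pE.
(* The shear map keeps the second coordinate, hence so does its inverse. *)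
have d2 e e' : bw E e = bw E e' -> (d (e, e')).2 = e'.
  by move=> ee; have [] := da (e, e') ee.
exists (fun e e' => (d (e, e')).1); split.
- by apply: cont_in_eq (cont_in_fst _ _ dc) => -[].
- by move=> e e' ee; have := dA (e, e') ee; rewrite /act_dom /= d2.
- by move=> e e' ee; have [+ _] := da (e, e') ee; rewrite d2.
by move=> g e ge; rewrite (ad (g, e) ge).
Qed.

End Principal.

(** * Bundle maps and isomorphisms *)

Definition is_bmap {G : topgroupoid} {X : topologicalType}
    (E E' : bundle G X) (phi : btot E -> btot E') : Prop :=
  [/\ continuous phi, forall e, bp E' (phi e) = bp E e,
      forall e, bw E' (phi e) = bw E e &
      forall g e, gdom g = bp E e -> phi (bact E g e) = bact E' g (phi e)].

(* Over [E x_X E'] the inverse of [phi] is [(e, e') |-> (e' / phi e) . e]; the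
   projection of [E x_X E'] to [E'] is an open surjection. *)
Lemma bmap_iso {G : topgroupoid} {X : topologicalType}
    (E E' : bundle G X) (phi : btot E -> btot E') :
  is_principal E -> is_principal E' -> is_bmap E E' phi -> bundle_iso E E'.
Proof.
move=> pE pE' [cphi pphi wphi aphi]; exists phi; split => //.
have [d [dc dd da ad]] := principal_division _ pE'.
have [d0 [_ dd0 da0 _]] := principal_division _ pE.
have surj e' : exists e, phi e = e'.
  have [e we] := bw_surj _ pE (bw E' e').
  have ww : bw E' e' = bw E' (phi e) by rewrite wphi.
  exists (bact E (d e' (phi e)) e); rewrite aphi ?da //.
  by rewrite dd ?pphi.
(* The arrow carrying [e2] to [e1] fixes [phi e2]; the action on [E'] is free, so this arrow is a
   unit. *)
have inj e1 e2 : phi e1 = phi e2 -> e1 = e2.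
  move=> h; have ww : bw E e1 = bw E e2 by rewrite -!wphi h.
  have h0 : gdom (d0 e1 e2) = bp E' (phi e2) by rewrite pphi dd0.
  have := ad (d0 e1 e2) (phi e2) h0.
  rewrite -aphi ?dd0 // da0 // h => h1; rewrite -(da0 _ _ ww) -h1.
  have := ad (gunit (bp E' (phi e2))) (phi e2) (gdom1 _).
  by rewrite bact1 // => ->; rewrite pphi bact1.
have [psi psiK] := choice surj.
exists psi; split=> //; first by move=> e _; apply: inj; rewrite psiK.
split; apply/cont_inP; first exact/cont_inT.
pose A := [set q : btot E * btot E' | [/\ setT q.1, setT q.2 &
  bw E q.1 = bw E' q.2]].
apply: (cont_in_descend A setT snd) => //.
- by move=> e' _; exists (psi e', e') => //; split; rewrite //= -wphi psiK.
- apply: (open_on_pullback setT setT setT) => //; first exact: bw_open.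
  exact/cont_inT/(bw_cont _ pE').
apply: (cont_in_eq _ (fun q => bact E (d q.2 (phi q.1)) q.1)).
  move=> [e e'] [_ _ /= w]; apply: inj; rewrite psiK aphi ?da ?wphi //.
  by rewrite dd ?wphi // pphi.
have c1 := cont_in_fst _ _ (cont_in_id A).
apply: bact_cont => //.
  by move=> [e e'] [_ _ /= w]; rewrite dd ?wphi // pphi.
apply: (cont_in_comp _ [set q : btot E' * btot E' | bw E' q.1 = bw E' q.2]
  (fun q => d q.1 q.2) (fun q => (q.2, phi q.1))) => //.
  by move=> [e e'] [_ _ /= w]; rewrite wphi.
apply: cont_in_pair; first exact: cont_in_snd (cont_in_id _).
exact: cont_in_compT.
Qed.

Lemma bundle_iso_refl {G : topgroupoid} {X : topologicalType}
  (E : bundle G X) : bundle_iso E E.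
Proof.
exists id; split => //; exists id; split => //.
by split; apply/cont_inP; exact: cont_in_id.
Qed.

Lemma bundle_iso_sym {G : topgroupoid} {X : topologicalType}
  (E E' : bundle G X) : bundle_iso E E' -> bundle_iso E' E.
Proof.
move=> [f [[g [_ fK gK [cf cg]]] pf wf af]]; exists g; split => //.
- by exists f.
- by move=> e; rewrite -pf gK.
- by move=> e; rewrite -wf gK.
move=> h e he; rewrite -[RHS]fK // af ?gK //.
by rewrite -pf gK.
Qed.

Lemma bundle_iso_trans {G : topgroupoid} {X : topologicalType}
    (E E' E'' : bundle G X) :
  bundle_iso E E' -> bundle_iso E' E'' -> bundle_iso E E''.
Proof.
move=> [f [[f' [_ fK f'K [cf cf']]] pf wf af]].
move=> [g [[g' [_ gK g'K [cg cg']]] pg wg ag]].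
exists (g \o f); split => /=.
- exists (f' \o g'); split => //=.
  + by move=> e _; rewrite gK ?fK.
  + by move=> e _; rewrite f'K ?g'K.
  by split; apply/cont_inP; apply: (@cont_in_comp _ _ _ _ setT) => //;
    apply/cont_inP.
- by move=> e; rewrite pg pf.
- by move=> e; rewrite wg wf.
by move=> h e he; rewrite af // ag // pf.
Qed.

Lemma bundle_iso_bmap {G : topgroupoid} {X : topologicalType}
  (E E' : bundle G X) : bundle_iso E E' -> exists phi, is_bmap E E' phi.
Proof.
move=> [f [[_ [_ _ _ [/cont_inP/cont_inT cf _]]] pf wf af]].
by exists f.
Qed.

(** * The bundle induced along an essential equivalence *)

Section Pullback.
Context {G : topgroupoid} {X Y : topologicalType} (f : Y -> X).
Implicit Types E : bundle G X.

Lemma val_pb_act E (g : garr G) (z : set_type (pb_set f E)) :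
  is_principal E -> gdom g = bp E (val z).1 ->
  val (pb_act f E g z) = (bact E g (val z).1, (val z).2).
Proof.
move=> pE gz; rewrite /pb_act; case: pselect => // -[].
by rewrite /pb_set /= bwM //; exact: (set_valP z).
Qed.

(** Points over the same [y] have first components in the same fibre of [E], so the division map of
    [E] divides them too. Openness of the projection is base change of [bw E]. *)
Lemma pullback_principal E :
  continuous f -> is_principal E -> is_principal (pullback f E).
Proof.
move=> cf pE; have [d [dc dd da ad]] := principal_division _ pE.
have cv : cont_in setT (val : set_type (pb_set f E) -> _).
  exact/cont_inT/val_cont.
apply: (principal_intro (pullback f E)
  (fun z z' : set_type (pb_set f E) => d (val z).1 (val z').1)).
- apply/cont_inT; apply: cont_in_compT; first exact: bp_cont.
  exact: cont_in_fst.
- by apply/cont_inT; exact: cont_in_snd.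
- apply: cont_in_val => /=.
  apply: (cont_in_eq _ (fun q : garr G * btot (pullback f E) =>
    (bact E q.1 (val q.2).1, (val q.2).2))).
    by move=> [g z] h; rewrite val_pb_act.
  have c2 : cont_in (act_dom (pullback f E)) (fun q => val q.2).
    apply: cont_in_compT; first exact: val_cont.
    exact: cont_in_snd (cont_in_id _).
  apply: cont_in_pair; last exact: cont_in_snd.
  apply: bact_cont => //; last exact: cont_in_fst.
  exact: cont_in_fst (cont_in_id _).
- split=> [g z h|z|g h z gh hz|g z h].
  + by rewrite /= val_pb_act //= bpM.
  + by apply: val_inj; rewrite /= val_pb_act ?gdom1 //= bact1 //; case: val.
  + apply: val_inj; rewrite /= !val_pb_act //= ?bactA ?gdomM //.
    by rewrite bpM.
  + by rewrite /= val_pb_act.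
- move=> y; have [e we] := bw_surj _ pE (f y).
  by exists (to_set_type (we : pb_set f E (e, y))).
- have o := open_on_pullback setT setT setT (bw E) f (fun _ _ => Logic.I)
    (bw_open _ pE) (proj1 (cont_inT f) cf).
  apply: (open_on_comp _ _ _ (val : set_type (pb_set f E) -> _) snd
    (fun z _ => set_valP z) (open_on_val _)).
  suff -> : pb_set f E = [set p | [/\ setT p.1, setT p.2 & bw E p.1 = f p.2]].
    by [].
  by apply/seteqP; split=> [z|z []].
split.
- apply: (cont_in_comp _ _ (fun q => d q.1 q.2)
    (fun q : set_type _ * set_type _ => ((val q.1).1, (val q.2).1))) dc => //.
    move=> [z z'] /= zz; move: (set_valP z) (set_valP z').
    by rewrite /pb_set /= zz => -> ->.
  have ci := cont_in_id [set q : set_type (pb_set f E) * set_type (pb_set f E) |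
     (val q.1).2 = (val q.2).2].
  apply: cont_in_pair; apply: cont_in_fst; apply: cont_in_compT;
    by [exact: val_cont|exact: cont_in_fst ci|exact: cont_in_snd ci].
- move=> z z' zz; rewrite /= dd //; move: (set_valP z) (set_valP z').
  by move: zz; rewrite /pb_set /= => -> -> ->.
- move=> z z' zz; have ww : bw E (val z).1 = bw E (val z').1.
    move: (set_valP z) (set_valP z').
    by move: zz; rewrite /pb_set /= => -> -> ->.
  apply: val_inj; rewrite /= val_pb_act ?dd //= da //.
  by move: zz; rewrite /= => <-; case: val.
by move=> g z h; rewrite /= val_pb_act // ad.
Qed.

Lemma pullback_bmap E E' : is_principal E -> is_principal E' ->
  bundle_iso E E' -> exists phi, is_bmap (pullback f E) (pullback f E') phi.
Proof.
move=> pE pE' /bundle_iso_bmap [phi [cphi pphi wphi aphi]].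
have h (z : set_type (pb_set f E)) : pb_set f E' (phi (val z).1, (val z).2).
  by rewrite /pb_set /= wphi; exact: (set_valP z).
exists (fun z : set_type (pb_set f E) => to_set_type (h z)); split => //=.
- apply/cont_inT; apply: cont_in_val => /=.
  have cv : cont_in setT (val : set_type (pb_set f E) -> _).
    exact/cont_inT/val_cont.
  apply: cont_in_pair; last exact: cont_in_snd.
  by apply: cont_in_compT => //; exact: cont_in_fst.
move=> g z gz; apply: val_inj; rewrite /= !val_pb_act //= ?pphi ?aphi //.
Qed.

Lemma pullback_iso E E' : continuous f -> is_principal E -> is_principal E' ->
  bundle_iso E E' -> bundle_iso (pullback f E) (pullback f E').
Proof.
move=> cf pE pE' /(pullback_bmap _ _ pE pE') [phi]; apply: bmap_iso;
exact: pullback_principal.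
Qed.

End Pullback.

Definition ind_set {G H : topgroupoid} {X : topologicalType} (F : gfunctor H G)
    (E : bundle G X) : set (btot E * gobj H) :=
  [set z | bp E z.1 = fobj F z.2].

(** For principal [E] and composable [h], the new pair lies in [ind_set F E], so the default [z]
    matters only outside the domain of the action. *)
Definition ind_act {G H : topgroupoid} {X : topologicalType} (F : gfunctor H G)
    (E : bundle G X) (h : garr H) (z : set_type (ind_set F E)) :
    set_type (ind_set F E) :=
  insubd_set z (bact E (farr F h) (val z).1, gcod h).

(* The [H]-bundle [E x_{G_0} H_0] induced by the [G]-bundle [E]. *)
Definition induced {G H : topgroupoid} {X : topologicalType} (F : gfunctor H G)
    (E : bundle G X) : bundle H X :=
  @Bundle H X (set_type (ind_set F E))
    (fun z => (val z).2) (fun z => bw E (val z).1) (ind_act F E).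

Section EssentialEquiv.
Context {G H : topgroupoid} (F : gfunctor H G).
Context (eF : essential_equiv F).

Lemma fobj_cont : continuous (fobj F).
Proof. by have [[[]]] := eF. Qed.

Lemma farr_cont : continuous (farr F).
Proof. by have [[[]]] := eF. Qed.

Lemma gdomF h : gdom (farr F h) = fobj F (gdom h).
Proof. by have [[]] := eF. Qed.

Lemma gcodF h : gcod (farr F h) = fobj F (gcod h).
Proof. by have [[]] := eF. Qed.

Lemma farr1 x : farr F (gunit x) = gunit (fobj F x).
Proof. by have [[]] := eF. Qed.

Lemma farrM h k : gdom h = gcod k ->
  farr F (gcomp h k) = gcomp (farr F h) (farr F k).
Proof. by have [[_ _ _ _ +]] := eF => + _ _; apply. Qed.

Lemma farrV h : farr F (ginv h) = ginv (farr F h).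
Proof.
rewrite -[LHS](gcompKV (farr F h)); last by rewrite gdomF gcodF gcodV.
rewrite -farrM ?gcodV // gcompgV farr1 -gcodF -gdomV gcompg1 //.
Qed.

Lemma fobj_surj x :
  exists g y, gdom g = fobj F y /\ gcod g = x.
Proof.
have [_ [es _] _] := eF; have [[g y] /= gy gx] := es x.
by exists g, y.
Qed.

Lemma fobj_open :
  open_on [set q : garr G * gobj H | gdom q.1 = fobj F q.2] setT
    (fun q => gcod q.1).
Proof. by have [_ [_ eo] _] := eF; apply/open_onT. Qed.

(** [l] inverts the homeomorphism in [essential_equiv]: [l (g, (x, y))] is the unique arrow from [x]
    to [y] lying over [g], and it depends continuously on the data. *)
Lemma full_faithful : exists l : garr G * (gobj H * gobj H) -> garr H,
  [/\ cont_in [set t | gdom t.1 = fobj F t.2.1 /\ gcod t.1 = fobj F t.2.2] l,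
      forall g x y, gdom g = fobj F x -> gcod g = fobj F y ->
        [/\ farr F (l (g, (x, y))) = g, gdom (l (g, (x, y))) = x &
            gcod (l (g, (x, y))) = y] &
      forall h, l (farr F h, (gdom h, gcod h)) = h].
Proof.
have [_ _ [l [_ lK Kl [_ /cont_inP lc]]]] := eF; exists l; split => //.
  by move=> g x y gx gy; have /= [-> -> ->] := Kl (g, (x, y)) (conj gx gy).
by move=> h; exact: lK.
Qed.

Section OneBase.
Context {X : topologicalType}.
Implicit Types E : bundle G X.

Lemma val_ind_act E h (z : set_type (ind_set F E)) :
  is_principal E -> gdom h = (val z).2 ->
  val (ind_act F E h z) = (bact E (farr F h) (val z).1, gcod h).
Proof.
move=> pE hz; rewrite val_insubd_set // /ind_set /= bpM ?gcodF // gdomF // hz.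
exact: esym (set_valP z).
Qed.

Lemma ind_setP E (z : set_type (ind_set F E)) h :
  gdom h = (val z).2 -> gdom (farr F h) = bp E (val z).1.
Proof. by rewrite gdomF (set_valP z) => ->. Qed.

(* The cover [(g, (e, y)) |-> g . e] of [E]. *)
Definition spread E : set (garr G * (btot E * gobj H)) :=
  [set p | gdom p.1 = bp E p.2.1 /\ bp E p.2.1 = fobj F p.2.2].

(** In the coordinates [((g, y), g . e)] the map becomes the projection of [C] to [E], which is the
    base change along [bp E] of the open map [cod] attached to the essential equivalence. *)
Lemma spread_open E : is_principal E ->
  open_on (spread E) setT (fun p => bact E p.1 p.2.1).
Proof.
move=> pE.
pose C := [set p : (garr G * gobj H) * btot E |
  [/\ gdom p.1.1 = fobj F p.1.2, setT p.2 & gcod p.1.1 = bp E p.2]].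
have co : open_on C setT snd.
  apply: (open_on_pullback [set q : garr G * gobj H | gdom q.1 = fobj F q.2]
    setT setT (fun q => gcod q.1) (bp E)) => //; first exact: fobj_open.
  exact/cont_inT/bp_cont.
apply: (open_on_cancel C (spread E) setT
  (fun p => (p.1.1, (bact E (ginv p.1.1) p.2, p.1.2)))).
- by move=> [[g y] e] [/= gy _ ge]; split; rewrite /= bpM ?gcodV ?gdomV.
- move=> [g [e y]] [/= ge ey]; exists ((g, y), bact E g e).
    by split; rewrite //= ?ge // bpM.
  by rewrite /= bactK.
- have c1 := cont_in_fst _ _ (cont_in_id C).
  have c11 := cont_in_fst _ _ c1.
  apply: cont_in_pair => //; apply: cont_in_pair; last exact: cont_in_snd.
  apply: bact_cont => //; last exact: cont_in_snd (cont_in_id C).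
    by move=> [[g y] e] [/= gy _ ge]; rewrite gdomV.
  by apply: cont_in_compT => //; exact: ginv_cont.
apply: open_on_eq co => -[[g y] e] [/= gy _ ge].
by rewrite bactVK.
Qed.

Lemma spread_surj E (e : btot E) : is_principal E ->
  exists2 p, spread E p & bact E p.1 p.2.1 = e.
Proof.
move=> pE; have [g [y [gy ge]]] := fobj_surj (bp E e).
exists (g, (bact E (ginv g) e, y)); last by rewrite /= bactVK.
by split; rewrite /= bpM ?gcodV ?gdomV.
Qed.

Lemma induced_principal E : is_principal E -> is_principal (induced F E).
Proof.
move=> pE; have [d [dc dd da ad]] := principal_division _ pE.
have [l [lc lP lK]] := full_faithful.
have cv : cont_in setT (val : set_type (ind_set F E) -> _).
  exact/cont_inT/val_cont.
(* Dividing the [E]-components gives an arrow from [F y'] to [F y]; full faithfulness lifts it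
   uniquely to an arrow from [y'] to [y]. *)
pose D (z z' : set_type (ind_set F E)) :=
  l (d (val z).1 (val z').1, ((val z').2, (val z).2)).
have dP (z z' : set_type (ind_set F E)) : bw E (val z).1 = bw E (val z').1 ->
    gdom (d (val z).1 (val z').1) = fobj F (val z').2 /\
    gcod (d (val z).1 (val z').1) = fobj F (val z).2.
  move=> zz; move: (set_valP z) (set_valP z'); rewrite /ind_set /= => <- <-.
  by rewrite dd // -{2}(da _ _ zz) bpM ?dd.
have DP (z z' : set_type (ind_set F E)) : bw E (val z).1 = bw E (val z').1 ->
    [/\ farr F (D z z') = d (val z).1 (val z').1, gdom (D z z') = (val z').2 &
        gcod (D z z') = (val z).2].
  by move=> /dP [h1 h2]; exact: lP.
apply: (principal_intro (induced F E) D).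
- by apply/cont_inT; exact: cont_in_snd.
- apply/cont_inT; apply: cont_in_compT; first exact: bw_cont.
  exact: cont_in_fst.
- apply: cont_in_val => /=.
  apply: (cont_in_eq _ (fun q : garr H * btot (induced F E) =>
    (bact E (farr F q.1) (val q.2).1, gcod q.1))).
    by move=> [g z] h; rewrite val_ind_act.
  have c1 := cont_in_fst _ _ (cont_in_id (act_dom (induced F E))).
  apply: cont_in_pair; last by apply: cont_in_compT => //; exact: gcod_cont.
  apply: bact_cont => //.
  + by move=> [h z] hz; exact: ind_setP.
  + by apply: cont_in_compT => //; exact: farr_cont.
  + apply: cont_in_fst; apply: cont_in_compT; first exact: val_cont.
    exact: cont_in_snd (cont_in_id _).
- split=> [g z h|z|g h z gh hz|g z h].
  + by rewrite /= val_ind_act.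
  + apply: val_inj; rewrite /= val_ind_act ?gdom1 //= farr1 gcod1.
    move: (set_valP z); rewrite /ind_set /= => <-; rewrite bact1 //.
    by case: val.
  + apply: val_inj; have /= hz' := ind_setP _ _ _ hz.
    rewrite /= !val_ind_act ?gdomM //= gcodM // farrM // bactA //.
    by rewrite gdomF gcodF gh.
  + by rewrite /= val_ind_act //= bwM //; exact: ind_setP.
- move=> x; have [e we] := bw_surj _ pE x.
  have [[g [e' y]] [/= ge ey] ee] := spread_surj E e pE.
  exists (to_set_type (ey : ind_set F E (e', y))).
  by rewrite /= -we -ee bwM.
- apply: (open_on_comp _ _ _ (val : set_type (ind_set F E) -> _)
    (fun p => bw E p.1) (fun z _ => set_valP z) (open_on_val _)).
  (* On [spread E] one has [w(e) = w(g . e)], and the latter is the open cover of [E] followed by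
     the open map [bw E]. Units show that [spread E] maps onto [ind_set F E]. *)
  apply: (open_on_cancel (spread E) _ _ snd) => //.
  + by move=> [g [e y]] [].
  + by move=> [e y] ey; exists (gunit (bp E e), (e, y)) => //;
      split; rewrite //= gdom1.
  + exact: cont_in_snd (cont_in_id _).
  apply: (open_on_eq _ _ (fun p => bw E (bact E p.1 p.2.1))).
    by move=> [g [e y]] [ge ey]; rewrite bwM.
  apply: (open_on_comp _ setT) => //; first exact: spread_open.
  exact: bw_open.
split.
- apply: cont_in_comp lc; first by move=> [z z'] /= /dP.
  set B := [set q | _].
  have cB1 : cont_in B (fun q => val q.1).
    apply: cont_in_compT; first exact: val_cont.
    exact: cont_in_fst (cont_in_id _).
  have cB2 : cont_in B (fun q => val q.2).
    apply: cont_in_compT; first exact: val_cont.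
    exact: cont_in_snd (cont_in_id _).
  apply: cont_in_pair; last by apply: cont_in_pair; exact: cont_in_snd.
  apply: (cont_in_comp _ _ (fun q => d q.1 q.2)
    (fun q : set_type _ * set_type _ => ((val q.1).1, (val q.2).1))) dc => //.
  by apply: cont_in_pair; exact: cont_in_fst.
- by move=> z z' /DP [].
- move=> z z' zz; have [e1 e2 e3] := DP _ _ zz.
  apply: val_inj; rewrite val_ind_act // e1 e3 da //.
  exact: esym (surjective_pairing _).
move=> h z hz; rewrite /D /= val_ind_act //= ad; last exact: ind_setP.
by rewrite -[RHS]lK hz.
Qed.

Lemma induced_iso E E' : is_principal E -> is_principal E' ->
  bundle_iso E E' -> bundle_iso (induced F E) (induced F E').
Proof.
move=> pE pE' /bundle_iso_bmap [phi [cphi pphi wphi aphi]].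
have h (z : set_type (ind_set F E)) : ind_set F E' (phi (val z).1, (val z).2).
  by rewrite /ind_set /= pphi; exact: (set_valP z).
apply: (bmap_iso (induced F E) (induced F E')
    (fun z : set_type (ind_set F E) => to_set_type (h z)));
  [exact: induced_principal..|split => //=].
- apply/cont_inT; apply: cont_in_val => /=.
  have cv : cont_in setT (val : set_type (ind_set F E) -> _).
    exact/cont_inT/val_cont.
  apply: cont_in_pair; last exact: cont_in_snd.
  by apply: cont_in_compT => //; exact: cont_in_fst.
move=> g z gz; apply: val_inj; rewrite /= !val_ind_act //= aphi //.
exact: ind_setP.
Qed.

(* A map [psi] of induced bundles descends along [spread]:
   [Psi (g . e) = g . psi (e, y)]. *)
Lemma induced_reflect E E' : is_principal E -> is_principal E' ->
  bundle_iso (induced F E) (induced F E') -> bundle_iso E E'.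
Proof.
move=> pE pE' /bundle_iso_bmap [psi [cpsi ppsi wpsi apsi]].
have [l [lc lP lK]] := full_faithful.
pose m (z : set_type (ind_set F E)) := (val (psi z)).1.
have pm (z : set_type (ind_set F E)) : bp E' (m z) = bp E (val z).1.
  rewrite /m (set_valP (psi z)) (set_valP z); congr fobj.
  exact: (ppsi z).
have am h (z : set_type (ind_set F E)) : gdom h = (val z).2 ->
    m (ind_act F E h z) = bact E' (farr F h) (m z).
  move=> hz; rewrite /m (apsi h z hz) /= val_ind_act //.
  by rewrite hz; exact: esym (ppsi z).
(* Two presentations of one point of [E] differ by the arrow [g'^-1 g]. It lifts to an arrow [h] of
   [H] with [z' = h . z], and equivariance of [psi] absorbs [h]. *)
have wd g (z : set_type (ind_set F E)) g' z' :
    gdom g = bp E (val z).1 -> gdom g' = bp E (val z').1 ->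
    bact E g (val z).1 = bact E g' (val z').1 ->
    bact E' g (m z) = bact E' g' (m z').
  move=> gz gz' gg.
  have gc : gcod g = gcod g'.
    by rewrite -(bpM _ pE g (val z).1) // gg bpM.
  have [] := lP (gcomp (ginv g') g) (val z).2 (val z').2.
  - by rewrite gdomM ?gdomV // gz; exact: (set_valP z).
  - by rewrite gcodM ?gdomV // gcodV gz'; exact: (set_valP z').
  set h := l _ => fh dh ch.
  have ez : z' = ind_act F E h z.
    apply: val_inj; rewrite val_ind_act // fh ch -bactA ?gdomV //.
    by rewrite gg bactK //; case: val.
  rewrite ez am // fh bactA ?gdomM ?gdomV ?pm // ?gcodM ?gdomV ?gcodV //.
  by rewrite gcompVK.
pose C := [set p : garr G * set_type (ind_set F E) |
  gdom p.1 = bp E (val p.2).1].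
pose a (p : garr G * set_type (ind_set F E)) := bact E p.1 (val p.2).1.
have asurj e : exists p, C p /\ a p = e.
  have [[g [e' y]] [/= ge ey] ee] := spread_surj E e pE.
  by exists (g, to_set_type (ey : ind_set F E (e', y))).
(* [s] picks a presentation of each point, with no continuity; by [wd] every other presentation
   yields the same value of [Psi]. *)
have [s sP] := choice asurj.
pose Psi e := bact E' (s e).1 (m (s e).2).
have PsiE g z : gdom g = bp E (val z).1 ->
    Psi (bact E g (val z).1) = bact E' g (m z).
  by move=> gz; apply: wd => //; have [] := sP (bact E g (val z).1).
apply: (bmap_iso _ _ Psi) => //; split.
- apply/cont_inT.
  apply: (cont_in_descend C setT a) => //.
  + by move=> e _; have [p [Cp pe]] := asurj e; exists p.
  (* [C] is [spread E] with its second factor as a subtype; the comparison is a restriction of the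
     open map [id x val]. *)
  + have o1 : open_on C (spread E) (fun p => (p.1, val p.2)).
      have oo := open_on_prod _ _ _ _ _ _ (open_on_id [set: garr G])
        (open_on_val (ind_set F E)).
      have /= := open_on_restr _ _ (spread E) _ _ oo.
      suff -> : [set x | ((setT x.1 /\ setT x.2) /\
          spread E (x.1, (val x.2)))] = C.
        by apply=> -[g z] [_ /= ?]; split.
      apply/seteqP; split=> [[g z] [_ []]|[g z] gz] //.
      by split => //; split => //; exact: (set_valP z).
    apply: (open_on_comp _ (spread E) _ _ (fun p => bact E p.1 p.2.1)) o1 _.
      by move=> [g z] gz; split => //; exact: (set_valP z).
    exact: spread_open.
  apply: (cont_in_eq _ (fun p => bact E' p.1 (m p.2))).
    by move=> [g z] gz; rewrite PsiE.
  apply: bact_cont => //; first by move=> [g z] gz; rewrite pm.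
    exact: cont_in_fst (cont_in_id _).
  apply: cont_in_fst; apply: cont_in_compT; first exact: val_cont.
  by apply: cont_in_compT => //; exact: cont_in_snd (cont_in_id _).
- move=> e; have [[g z] [/= gz <-]] := asurj e.
  by rewrite PsiE // !bpM // pm.
- move=> e; have [[g z] [/= gz <-]] := asurj e.
  by rewrite PsiE // !bwM ?pm //; exact: (wpsi z).
move=> k e; have [[g z] [/= gz <-]] := asurj e; rewrite bpM // => kg.
by rewrite PsiE // !bactA ?pm // PsiE ?gdomM.
Qed.

End OneBase.

(** Both sides are the fibre product of [E] with [H_0] over [G_0] and with [Y] over [X]; the
    isomorphism only regroups the coordinates. *)
Lemma induced_pullback {X Y : topologicalType} (f : Y -> X) (E : bundle G X) :
  continuous f -> is_principal E ->
  bundle_iso (induced F (pullback f E)) (pullback f (induced F E)).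
Proof.
move=> cf pE; have pfE := pullback_principal f _ cf pE.
have pI := induced_principal _ pE.
pose S := ind_set F (pullback f E).
have h1 (z : set_type S) : ind_set F E ((val (val z).1).1, (val z).2).
  exact: (set_valP z).
have h2 (z : set_type S) : pb_set f (induced F E)
    (to_set_type (h1 z), (val (val z).1).2).
  exact: (set_valP (val z).1).
apply: (bmap_iso (induced F (pullback f E)) (pullback f (induced F E))
    (fun z : set_type S => to_set_type (h2 z))).
- exact: induced_principal.
- exact: pullback_principal.
have cv : cont_in setT (val : set_type S -> _) by exact/cont_inT/val_cont.
have cvv : cont_in setT (fun z : set_type S => val (val z).1).
  by apply: cont_in_compT; [exact: val_cont|exact: cont_in_fst].
split => //.
- apply/cont_inT; apply: cont_in_val => /=.
  apply: cont_in_pair; last exact: cont_in_snd.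
  apply: cont_in_val => /=.
  by apply: cont_in_pair; [exact: cont_in_fst|exact: cont_in_snd].
move=> h z hz; have hz' := ind_setP _ z h hz.
have /= ez := val_ind_act _ h z pfE hz.
have /= e1 := val_ind_act _ h (to_set_type (h1 z)) pE hz.
have /= ep := val_pb_act f E (farr F h) (val z).1 pE hz'.
have /= e2 := val_pb_act f (induced F E) h (to_set_type (h2 z)) pI hz.
apply: val_inj; rewrite /= e2; congr (_, _).
  by apply: val_inj; rewrite /= ez e1 /= ep.
by rewrite ez /= ep.
Qed.

End EssentialEquiv.

(** * Essential surjectivity *)

Section Associated.
Context {G H : topgroupoid} (F : gfunctor H G) (eF : essential_equiv F).
Context {X : topologicalType} (B : bundle H X) (pB : is_principal B).

Definition assoc_set : set (garr G * btot B) :=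
  [set q | gdom q.1 = fobj F (bp B q.2)].

Local Notation T := (set_type assoc_set).

(* [(g . F h, b)] is identified with [(g, h . b)]. *)
Definition assoc_rel (z z' : T) : Prop :=
  exists h, [/\ gdom h = bp B (val z).2, (val z').2 = bact B h (val z).2 &
    (val z).1 = gcomp (val z').1 (farr F h)].

Lemma assocP (z : T) : gdom (val z).1 = fobj F (bp B (val z).2).
Proof. exact: (set_valP z). Qed.

Lemma assoc_comp (z z' : T) h : gdom h = bp B (val z).2 ->
  (val z').2 = bact B h (val z).2 -> gdom (val z').1 = gcod (farr F h).
Proof. by move=> hz e; rewrite assocP e bpM // gcodF. Qed.

Lemma assoc_rel_refl z : assoc_rel z z.
Proof.
exists (gunit (bp B (val z).2)); split; rewrite ?gdom1 ?bact1 //.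
by rewrite farr1 // -assocP gcompg1.
Qed.

Lemma assoc_rel_sym z z' : assoc_rel z z' -> assoc_rel z' z.
Proof.
move=> [h [h1 h2 h3]]; exists (ginv h); have zz := assoc_comp _ _ _ h1 h2.
by split; rewrite ?gdomV ?h2 ?bpM ?bactK // h3 farrV // gcompMV.
Qed.

Lemma assoc_rel_trans x y z : assoc_rel x y -> assoc_rel y z -> assoc_rel x z.
Proof.
move=> [h [h1 h2 h3]] [k [k1 k2 k3]].
have kh : gdom k = gcod h by rewrite k1 h2 bpM.
exists (gcomp k h); split; rewrite ?gdomM //.
  by rewrite k2 h2 bactA.
have yz := assoc_comp _ _ _ k1 k2.
by rewrite h3 k3 farrM // gcompA // gdomF ?gcodF // kh.
Qed.

Definition assoc_act (k : garr G) (z : T) : T :=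
  insubd_set z (gcomp k (val z).1, (val z).2).

Lemma val_assoc_act k z : gdom k = gcod (val z).1 ->
  val (assoc_act k z) = (gcomp k (val z).1, (val z).2).
Proof.
by move=> kz; rewrite val_insubd_set // /assoc_set /= gdomM // assocP.
Qed.

Context {Q : topologicalType} (pi : T -> Q).
Context (cpi : continuous pi) (piE : forall x y, pi x = pi y <-> assoc_rel x y).
Context (opi : forall U, open (pi @^-1` U) -> open U).
Context (s : Q -> T) (sK : forall q, pi (s q) = q).

(** The structure maps are read off representatives chosen by [s], which need not be continuous.
    Independence of the representative is proved below, and continuity is then obtained by descent
    along [pi]. *)
Definition assoc_bundle : bundle G X :=
  @Bundle G X Q (fun q => gcod (val (s q)).1) (fun q => bw B (val (s q)).2)
    (fun k q => pi (assoc_act k (s q))).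

Lemma assoc_act_rel k z z' : gdom k = gcod (val z).1 -> assoc_rel z z' ->
  assoc_rel (assoc_act k z) (assoc_act k z').
Proof.
move=> kz [h [h1 h2 h3]]; have zz := assoc_comp _ _ _ h1 h2.
have cz : gcod (val z).1 = gcod (val z').1 by rewrite h3 gcodM.
exists h; rewrite !val_assoc_act -?cz //=; split => //.
by rewrite h3 gcompA // -cz.
Qed.

Lemma assoc_bpE z : bp assoc_bundle (pi z) = gcod (val z).1.
Proof.
have /piE [h [h1 h2 h3]] := sK (pi z).
by rewrite /= h3 gcodM //; exact: assoc_comp h2.
Qed.

Lemma assoc_bwE z : bw assoc_bundle (pi z) = bw B (val z).2.
Proof.
by have /piE [h [h1 h2 h3]] := sK (pi z); rewrite /= h2 bwM.
Qed.

Lemma assoc_bactE k z : gdom k = gcod (val z).1 ->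
  bact assoc_bundle k (pi z) = pi (assoc_act k z).
Proof.
move=> kz; apply/piE; apply: assoc_act_rel; last exact/piE/sK.
by rewrite kz -assoc_bpE.
Qed.

(** The saturation of an open [V] is open because [dom] of [H] is. A pair [(h, z)] with [z = (g, b)]
    is sent by [m] to [(g . F(h)^-1, h . b)], in the class of [z]; the pairs that [m] sends into [V]
    form an open set, and their projection to [z] is a base change of [dom]. *)
Lemma assoc_pi_open : open_on setT setT pi.
Proof.
apply/open_onT => V oV; rewrite setTI; apply: opi.
rewrite openE => y [w Vw /esym/piE [h [h1 h2 h3]]].
pose A := [set p : garr H * T | [/\ setT p.1, setT p.2 &
  gdom p.1 = bp B (val p.2).2]].
pose m (p : garr H * T) : T := insubd_set p.2
  (gcomp (val p.2).1 (ginv (farr F p.1)), bact B p.1 (val p.2).2).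
have dA p : A p -> gdom (val p.2).1 = gcod (ginv (farr F p.1)).
  by move=> [_ _ hz]; rewrite assocP gcodV gdomF // hz.
have vm p : A p -> val (m p) =
    (gcomp (val p.2).1 (ginv (farr F p.1)), bact B p.1 (val p.2).2).
  move=> /[dup] Ap [_ _ hz]; rewrite val_insubd_set // /assoc_set /=.
  by rewrite gdomM ?dA // gdomV gcodF // bpM.
have c1 := cont_in_fst _ _ (cont_in_id A).
have c2 : cont_in A (fun p => val p.2).
  apply: cont_in_compT; first exact: val_cont.
  exact: cont_in_snd (cont_in_id A).
have cm : cont_in A m.
  apply: cont_in_val.
  apply: (cont_in_eq _ (fun p : garr H * T =>
    (gcomp (val p.2).1 (ginv (farr F p.1)),
    bact B p.1 (val p.2).2))) => [p Ap|]; first by rewrite vm.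
  apply: cont_in_pair; last first.
    by apply: bact_cont => //; [move=> p []|exact: cont_in_snd].
  apply: gcomp_cont; [exact: dA|exact: cont_in_fst|].
  apply: cont_in_compT; first exact: ginv_cont.
  by apply: cont_in_compT => //; exact: farr_cont eF.
have Ay : A (h, y) by [].
have my : m (h, y) = w.
  apply: val_inj; rewrite vm //= -h2 h3 gcompMV;
    first exact: esym (surjective_pairing _).
  exact: assoc_comp h2.
have n : nbhs (m (h, y)) V by rewrite my; exact: open_nbhs_nbhs.
have oA : open_on A setT snd.
  apply: (open_on_pullback setT setT setT gdom
    (fun z : T => bp B (val z).2)) => //.
    exact: gdom_open.
  apply: cont_in_compT; first exact: bp_cont.
  by apply: cont_in_snd; exact/cont_inT/val_cont.
apply: filterS (oA _ Ay _ (cm _ Ay _ n)) => z /(_ Logic.I).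
move=> [p [Ap /(_ Ap) Vp] <-].
exists (m p) => //; apply/esym/piE; exists p.1; have [_ _ hz] := Ap.
split => //; rewrite vm //= -gcompA ?dA ?gdomV //.
by rewrite gcompVg gdomF // hz -assocP gcompg1.
Qed.

(** If [(k g, b)] and [(k' g, b)] are identified through [h], then [h . b = b]. Freeness on [B]
    makes [h] a unit, so [k g = k' g]. *)
Lemma assoc_free k k' q : gdom k = bp assoc_bundle q ->
  gdom k' = bp assoc_bundle q ->
  bact assoc_bundle k q = bact assoc_bundle k' q -> k = k'.
Proof.
have [d [_ _ _ ad]] := principal_division _ pB.
rewrite -(sK q) assoc_bpE => kq k'q; rewrite !assoc_bactE //.
move=> /piE [h []]; rewrite !val_assoc_act //= => h1 h2 h3.
have hE : h = gunit (bp B (val (s q)).2).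
  have := ad h _ h1; rewrite -h2 => <-.
  by rewrite -{1}(bact1 B pB (val (s q)).2) ad // gdom1.
move: h3; rewrite hE farr1 // -assocP -(gdomM k') // gcompg1 => e.
by rewrite -(gcompMV k (val (s q)).1) // e gcompMV.
Qed.

Lemma assoc_principal : is_principal assoc_bundle.
Proof.
have [d [dc dd da ad]] := principal_division _ pB.
have pis q : exists2 z, setT z & pi z = q by exists (s q).
have cv : cont_in setT (val : T -> _) by exact/cont_inT/val_cont.
(* With [z = (g, b)], [z' = (g', b')] and [b = h . b'], the pair [(g, h . b')] is identified with
   [(g . F h, b')], which is [g . F h . g'^-1] acting on [z']. *)
pose D0 (z z' : T) := gcomp (gcomp (val z).1 (farr F (d (val z).2 (val z').2)))
  (ginv (val z').1).
have D01 (z z' : T) : bw B (val z).2 = bw B (val z').2 ->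
    gdom (val z).1 = gcod (farr F (d (val z).2 (val z').2)).
  by move=> zz; rewrite gcodF // assocP -{1}(da _ _ zz) bpM ?dd.
have D02 (z z' : T) : bw B (val z).2 = bw B (val z').2 ->
    gdom (gcomp (val z).1 (farr F (d (val z).2 (val z').2))) =
    gcod (ginv (val z').1).
  by move=> zz; rewrite gdomM ?(D01 _ _ zz) // gcodV gdomF // dd // assocP.
have D0dom (z z' : T) : bw B (val z).2 = bw B (val z').2 ->
    gdom (D0 z z') = gcod (val z').1.
  by move=> zz; rewrite gdomM ?D02 // gdomV.
have D0act (z z' : T) : bw B (val z).2 = bw B (val z').2 ->
    bact assoc_bundle (D0 z z') (pi z') = pi z.
  move=> zz; rewrite assoc_bactE ?D0dom //; apply/piE.
  exists (d (val z).2 (val z').2); rewrite val_assoc_act ?D0dom //=.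
  rewrite dd ?da //; split => //.
  rewrite /D0 -gcompA ?gdomV ?D02 //.
  by rewrite gcompVg -gcodV -(D02 _ _ zz) gcompg1.
(* Both arrows carry [pi z'] to [pi z], so freeness makes them equal. *)
have D0E (z z' : T) : bw B (val z).2 = bw B (val z').2 ->
    D0 (s (pi z)) (s (pi z')) = D0 z z'.
  move=> zz; have zz' : bw B (val (s (pi z))).2 = bw B (val (s (pi z'))).2.
    by have := assoc_bwE z; have := assoc_bwE z' => /= -> ->.
  apply: (assoc_free _ _ (pi z')); rewrite ?assoc_bpE ?D0dom //.
    exact: assoc_bpE.
  by rewrite [RHS]D0act // -{2}(sK (pi z')) D0act // sK.
apply: (principal_intro assoc_bundle (fun q q' => D0 (s q) (s q'))).
- apply/cont_inT; apply: (cont_in_descend setT setT pi) => //.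
    exact: assoc_pi_open.
  apply: (cont_in_eq _ (fun z : T => gcod (val z).1)).
    by move=> z _; exact: esym (assoc_bpE z).
  by apply: cont_in_compT; [exact: gcod_cont|exact: cont_in_fst].
- apply/cont_inT; apply: (cont_in_descend setT setT pi) => //.
    exact: assoc_pi_open.
  apply: (cont_in_eq _ (fun z : T => bw B (val z).2)).
    by move=> z _; exact: esym (assoc_bwE z).
  by apply: cont_in_compT; [exact: bw_cont|exact: cont_in_snd].
- pose A := [set p : garr G * T | gdom p.1 = gcod (val p.2).1].
  (* Here [id x pi], restricted to the domain of the action, must have the quotient property;
     openness of [pi] provides it. *)
  apply: (cont_in_descend A (act_dom assoc_bundle) (fun p => (p.1, pi p.2))).
  + by move=> [k z] kz; rewrite /act_dom /= kz -assoc_bpE.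
  + by move=> [k q] kq; exists (k, s q); rewrite /= ?sK.
  + have oo := open_on_prod _ _ _ _ _ _ (open_on_id [set: garr G])
      assoc_pi_open.
    have /= := open_on_restr _ _ (act_dom assoc_bundle) _ _ oo.
    suff -> : [set x | ((setT x.1 /\ setT x.2) /\
        act_dom assoc_bundle (x.1, pi x.2))] = A by apply=> p _.
    apply/seteqP; split=> -[k z]; rewrite /A /act_dom /=.
      by move=> [_ ->]; exact: assoc_bpE.
    by move=> ->; split => //; exact: esym (assoc_bpE z).
  apply: (cont_in_eq _ (fun p => pi (assoc_act p.1 p.2))).
    by move=> [k z] kz; rewrite assoc_bactE.
  apply: cont_in_compT => //; apply: cont_in_val.
  apply: (cont_in_eq _ (fun p : garr G * T =>
    (gcomp p.1 (val p.2).1, (val p.2).2))).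
    by move=> [k z] kz; rewrite val_assoc_act.
  have c2 : cont_in A (fun p => val p.2).
    apply: cont_in_compT; first exact: val_cont.
    exact: cont_in_snd (cont_in_id A).
  apply: cont_in_pair; last exact: cont_in_snd.
  apply: gcomp_cont => //; last exact: cont_in_fst.
  exact: cont_in_fst (cont_in_id A).
- split=> [g q|q|g h q gh|g q]; rewrite -(sK q).
  + rewrite assoc_bpE => gq; rewrite assoc_bactE // assoc_bpE.
    by rewrite val_assoc_act //= gcodM.
  + rewrite assoc_bpE assoc_bactE ?gdom1 //; congr pi; apply: val_inj.
    rewrite val_assoc_act ?gdom1 // gcomp1g; exact: esym (surjective_pairing _).
  + rewrite assoc_bpE => hq; have vq := val_assoc_act _ _ hq.
    rewrite assoc_bactE // !assoc_bactE ?vq ?gcodM ?gdomM //.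
    congr pi; apply: val_inj.
    by rewrite !val_assoc_act ?gdomM //= ?gcodM // gcompA.
  + rewrite assoc_bpE => gq; rewrite assoc_bactE // !assoc_bwE.
    by rewrite val_assoc_act.
- move=> x; have [b bx] := bw_surj _ pB x.
  pose z : T := to_set_type (gdom1 (fobj F (bp B b)) :
    assoc_set (gunit (fobj F (bp B b)), b)).
  by exists (pi z); rewrite assoc_bwE.
(* After composition with [pi], the projection is [bw B] following [(g, b) |-> b], which is open as
   a base change of [dom] of [G]. *)
- apply: (open_on_cancel setT _ _ pi) => //; first exact/cont_inT.
  apply: (open_on_eq _ _ (fun z : T => bw B (val z).2)).
    by move=> z _; exact: esym (assoc_bwE z).
  apply: (open_on_comp _ setT setT (fun z : T => (val z).2) (bw B)) => //;
    last exact: bw_open.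
  apply: (open_on_comp _ _ _ (val : T -> _) snd
    (fun z _ => set_valP z) (open_on_val _)).
  have o := open_on_pullback setT setT setT gdom (fun b => fobj F (bp B b))
    (fun _ _ => Logic.I) gdom_open.
  suff -> : assoc_set =
      [set p | [/\ setT p.1, setT p.2 & gdom p.1 = fobj F (bp B p.2)]].
    apply: o; apply: cont_in_compT; first exact: fobj_cont.
    exact/cont_inT/bp_cont.
  by apply/seteqP; split=> [z|z []].
split.
- pose W := [set p : T * T | bw B (val p.1).2 = bw B (val p.2).2].
  apply: (cont_in_descend W _ (fun p => (pi p.1, pi p.2))).
  + by move=> [z z']; rewrite /W /=; have := assoc_bwE z;
      have := assoc_bwE z' => /= -> ->.
  + by move=> [q q'] /= qq; exists (s q, s q'); rewrite //= !sK.
  + have oo := open_on_prod _ _ _ _ _ _ assoc_pi_open assoc_pi_open.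
    have /= := open_on_restr _ _
      [set q | bw assoc_bundle q.1 = bw assoc_bundle q.2] _ _ oo.
    suff -> : [set x | (setT x.1 /\ setT x.2) /\
        bw assoc_bundle (pi x.1) = bw assoc_bundle (pi x.2)] = W.
      by apply=> p _.
    apply/seteqP; split=> -[z z']; rewrite /W /=; have := assoc_bwE z;
      have := assoc_bwE z' => /= -> ->; by [case|split].
  apply: (cont_in_eq _ (fun p => D0 p.1 p.2)).
    by move=> [z z'] zz; rewrite /= D0E.
  have c1 : cont_in W (fun p => val p.1).
    apply: cont_in_compT; first exact: val_cont.
    exact: cont_in_fst (cont_in_id W).
  have c2 : cont_in W (fun p => val p.2).
    apply: cont_in_compT; first exact: val_cont.
    exact: cont_in_snd (cont_in_id W).
  apply: gcomp_cont; first by move=> p; exact: D02.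
    apply: gcomp_cont; [by move=> p; exact: D01|exact: cont_in_fst|].
    apply: cont_in_compT; first exact: farr_cont.
    apply: (cont_in_comp _ _ (fun q => d q.1 q.2)
      (fun p : T * T => ((val p.1).2, (val p.2).2))) dc => //.
    by apply: cont_in_pair; exact: cont_in_snd.
  by apply: cont_in_compT; [exact: ginv_cont|exact: cont_in_fst].
- by move=> q q' qq; rewrite D0dom.
- by move=> q q' qq; rewrite -{2}(sK q') D0act // sK.
move=> g q gq.
have ww : bw assoc_bundle (bact assoc_bundle g q) = bw assoc_bundle q.
  move: gq; rewrite -(sK q) assoc_bpE => gq.
  by rewrite assoc_bactE // !assoc_bwE val_assoc_act.
apply: (assoc_free _ _ q) => //; first by rewrite D0dom.
have := D0act _ _ ww; rewrite (sK q) => ->; exact: sK.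
Qed.

(** The map goes from [B], where no representative has to be chosen: [b] is sent to the class of
    [(1, b)] paired with [bp B b]. It is equivariant because [(F h, b) = (1 . F h, b)] is identified
    with [(1, h . b)]. *)
Lemma assoc_induced : bundle_iso (induced F assoc_bundle) B.
Proof.
have pA := assoc_principal; apply: bundle_iso_sym.
pose u (b : btot B) : T := to_set_type (gdom1 (fobj F (bp B b)) :
    assoc_set (gunit (fobj F (bp B b)), b)).
have uP b : ind_set F assoc_bundle (pi (u b), bp B b).
  by have := assoc_bpE (u b); rewrite /= gcod1.
apply: (bmap_iso B (induced F assoc_bundle)
  (fun b => to_set_type (uP b))) => //.
  exact: induced_principal.
split => //.
- apply/cont_inT; apply: cont_in_val => /=.
  have cp : cont_in setT (bp B) by exact/cont_inT/bp_cont.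
  apply: cont_in_pair => //; apply: cont_in_compT => //.
  apply: cont_in_val => /=; apply: cont_in_pair; last exact: cont_in_id.
  apply: cont_in_compT; first exact: gunit_cont.
  by apply: cont_in_compT => //; exact: fobj_cont.
- by move=> b; exact: assoc_bwE.
move=> h b hb; apply: val_inj.
have hu : gdom (farr F h) = gcod (val (u b)).1 by rewrite /= gcod1 gdomF // hb.
have /= -> := val_ind_act _ eF assoc_bundle h (to_set_type (uP b)) pA hb.
rewrite bpM //; congr (_, _); rewrite -[RHS]/(bact assoc_bundle _ _).
rewrite (assoc_bactE _ _ hu); apply/esym/piE; exists h.
rewrite val_assoc_act //=; split => //.
rewrite bpM // -gcodF // gcomp1g -hb -gdomF // gcompg1 //.
Qed.

End Associated.

Lemma induced_surj {G H : topgroupoid} (F : gfunctor H G) {X : topologicalType}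
    (B : bundle H X) : essential_equiv F -> is_principal B ->
  exists2 E : bundle G X, is_principal E & bundle_iso (induced F E) B.
Proof.
move=> eF pB.
have [Q [pi [cpi spi piE opi]]] := quotient_space _ (assoc_rel_refl F eF B pB)
  (assoc_rel_sym F eF B pB) (assoc_rel_trans F eF B pB).
have [s sK] := choice spi.
exists (assoc_bundle F B pi s).
  exact: assoc_principal.
exact: assoc_induced.
Qed.

(** * Homology and cohomology *)

Local Open Scope ring_scope.

Lemma face_row_cont {m : nat} (i : 'I_m.+2) : continuous (@face_row m i).
Proof.
(* Entry [k] of [x] reappears at position [lift i k], which skips [i]. *)
move=> x V [P nP PV]; exists (fun=> fun k => P 0 (lift i k)).
  by move=> r k; rewrite ord1; have := nP 0 (lift i k); rewrite mxE liftK.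
move=> y yP; apply: PV => r j; rewrite (ord1 r) mxE.
case: unliftP => [k ->|->]; first exact: yP.
(* The inserted entry [i] is constantly 0, which lies in its own neighbourhood. *)
by apply: nbhs_singleton; have := nP 0 i; rewrite mxE unlift_none.
Qed.

Lemma face_cont {m : nat} (i : 'I_m.+2) : continuous (@face m i).
Proof.
apply/cont_inT; apply: cont_in_val => /=.
apply: cont_in_compT; first exact: face_row_cont.
exact/cont_inT/val_cont.
Qed.

(** A map of the sets [HS(Delta^n, -)] compatible with faces, given on representatives;
    compatibility therefore holds only up to isomorphism. *)
Definition hs_map {G H : topgroupoid}
    (T : forall n, bundle G (simplex n) -> bundle H (simplex n)) : Prop :=
  [/\ forall n E, is_principal E -> is_principal (T n E),
      forall n E E', is_principal E -> is_principal E' -> bundle_iso E E' ->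
        bundle_iso (T n E) (T n E') &
      forall m (i : 'I_m.+2) E, is_principal E ->
        bundle_iso (T m (pullback (face i) E))
                   (pullback (face i) (T m.+1 E))].

Definition hs_inverse {G H : topgroupoid}
    (T : forall n, bundle G (simplex n) -> bundle H (simplex n))
    (S : forall n, bundle H (simplex n) -> bundle G (simplex n)) : Prop :=
  forall n E, is_principal E -> bundle_iso (S n (T n E)) E.

Definition hs_equiv (G H : topgroupoid) : Prop :=
  exists (T : forall n, bundle G (simplex n) -> bundle H (simplex n))
         (S : forall n, bundle H (simplex n) -> bundle G (simplex n)),
    [/\ hs_map T, hs_map S, hs_inverse T S & hs_inverse S T].

Lemma hs_equiv_refl G : hs_equiv G G.
Proof.
exists (fun=> id), (fun=> id).
by split; [split=> // *|split=> // *|move=> *|move=> *];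
  exact: bundle_iso_refl.
Qed.

Lemma hs_equiv_sym G H : hs_equiv G H -> hs_equiv H G.
Proof. by move=> [T [S [*]]]; exists S, T. Qed.

Lemma hs_map_comp {G H K : topgroupoid}
    (T : forall n, bundle G (simplex n) -> bundle H (simplex n))
    (T' : forall n, bundle H (simplex n) -> bundle K (simplex n)) :
  hs_map T -> hs_map T' -> hs_map (fun n E => T' n (T n E)).
Proof.
move=> [Tp Ti Tn] [Tp' Ti' Tn']; split.
- by move=> n E pE; apply/Tp'/Tp.
- by move=> n E E' pE pE' EE; apply: Ti'; [exact: Tp..|exact: Ti].
move=> m i E pE; apply: bundle_iso_trans (Tn' _ _ _ (Tp _ _ pE)).
have pf := pullback_principal (face i) E (face_cont i) pE.
apply: Ti'; [exact: Tp| |exact: Tn].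
by apply: pullback_principal; [exact: face_cont|exact: Tp].
Qed.

Lemma hs_inverse_comp {G H K : topgroupoid}
    (T : forall n, bundle G (simplex n) -> bundle H (simplex n))
    (S : forall n, bundle H (simplex n) -> bundle G (simplex n))
    (T' : forall n, bundle H (simplex n) -> bundle K (simplex n))
    (S' : forall n, bundle K (simplex n) -> bundle H (simplex n)) :
  hs_map T -> hs_map T' -> hs_map S -> hs_map S' ->
  hs_inverse T S -> hs_inverse T' S' ->
  hs_inverse (fun n E => T' n (T n E)) (fun n E => S n (S' n E)).
Proof.
move=> [Tp _ _] [Tp' _ _] [_ Si _] [Sp' _ _] TS TS' n E pE.
apply: bundle_iso_trans (TS _ _ pE); apply: Si; last exact/TS'/Tp.
  exact/Sp'/Tp'/Tp.
exact: Tp.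
Qed.

Lemma hs_equiv_trans G H K : hs_equiv G H -> hs_equiv H K -> hs_equiv G K.
Proof.
move=> [T [S [mT mS TS ST]]] [T' [S' [mT' mS' TS' ST']]].
exists (fun n E => T' n (T n E)), (fun n E => S n (S' n E)).
by split; [exact: hs_map_comp..|exact: hs_inverse_comp|exact: hs_inverse_comp].
Qed.

(** A default value for the chosen inverse at non-principal data; having no points, it exists even
    when [G_0] is empty. *)
Definition empty_bundle (G : topgroupoid) (X : topologicalType) : bundle G X :=
  let absurd T (z : set_type (set0 : set nat)) : T :=
    False_rect T (set_valP z) in
  @Bundle G X (set_type (set0 : set nat)) (absurd _) (absurd _) (fun=> id).

(** [S] is chosen one bundle at a time and has no functoriality by construction. Each required
    isomorphism is established after inducing to [H] and then reflected back. *)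
Lemma essential_hs_equiv {G H : topgroupoid} (F : gfunctor H G) :
  essential_equiv F -> hs_equiv G H.
Proof.
move=> eF.
have inv n (B : bundle H (simplex n)) : exists E, is_principal B ->
    is_principal E /\ bundle_iso (induced F E) B.
  have [pB|nB] := pselect (is_principal B).
    by have [E pE EB] := induced_surj F B eF pB; exists E.
  by exists (empty_bundle G _).
pose S n B := projT1 (cid (inv n B)).
have SP n B := projT2 (cid (inv n B)) : is_principal B ->
  is_principal (S n B) /\ bundle_iso (induced F (S n B)) B.
have pI n (E : bundle G (simplex n)) := induced_principal F eF E.
have Sp n B pB := (SP n B pB).1; have SI n B pB := (SP n B pB).2.
have pf m (i : 'I_m.+2) (K : topgroupoid) (E : bundle K _) :=
  pullback_principal (face i) E (face_cont i).
exists (fun n => induced F), S; split => //.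
- split=> [n E|n E E'|m i E]; [exact: pI|exact: induced_iso|].
  by apply: induced_pullback => //; exact: face_cont.
- split=> [n E|n E E' pE pE' EE|m i E pE]; first exact: Sp.
    apply: (induced_reflect F eF); [exact: Sp..|].
    apply: bundle_iso_trans (SI _ _ pE) _.
    by apply: bundle_iso_trans EE _; exact/bundle_iso_sym/SI.
  have pfE := pf _ i _ _ pE; have pSE := Sp _ _ pE.
  apply: (induced_reflect F eF); [exact: Sp|exact: pf|].
  (* With [d] the face map, the bundle induced by [S] of the pullback of [E] is the pullback of [E],
     which is the pullback of the bundle induced by [S E]; induction commutes with pullback along
     [d]. *)
  apply: bundle_iso_trans (SI _ _ pfE) _.
  apply: bundle_iso_sym; apply: bundle_iso_trans.
    by apply: (induced_pullback F eF) => //; exact: face_cont.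
  by apply: pullback_iso; [exact: face_cont|exact: pI| |exact: SI].
move=> n E pE; apply: (induced_reflect F eF) => //; first exact/Sp/pI.
exact/SI/pI.
Qed.

Lemma morita_hs_equiv G H : morita_equiv G H -> hs_equiv G H.
Proof.
elim=> {G H} [H G F eF|G|G H _|G H K _ GH _ HK].
(* A functor from [H] to [G] induces [H]-bundles from [G]-bundles, whence the symmetry. *)
- by apply: hs_equiv_sym; exact: essential_hs_equiv eF.
- exact: hs_equiv_refl.
- exact: hs_equiv_sym.
- exact: hs_equiv_trans GH HK.
Qed.

(** The two predicates need agree only on listed elements, since comparisons of isomorphism classes
    are available only for the principal bundles of a chain. *)
Lemma big_In {R : zmodType} {I : Type} (s : seq I) (P Q : pred I) (a : I -> R) :
  (forall i, List.In i s -> P i = Q i) ->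
  \sum_(i <- s | P i) a i = \sum_(i <- s | Q i) a i.
Proof.
elim: s => [|i s IH] h; first by rewrite !big_nil.
rewrite !big_cons h ?IH //; first by move=> j js; apply: h; right.
by left.
Qed.

Lemma bundle_iso_eql {G : topgroupoid} {X : topologicalType}
    (E E' : bundle G X) : bundle_iso E E' ->
  forall K, `[< bundle_iso E K >] = `[< bundle_iso E' K >].
Proof.
move=> EE K; apply/asboolP/asboolP => h; last exact: bundle_iso_trans h.
by apply: bundle_iso_trans h; exact: bundle_iso_sym.
Qed.

(** * Chains up to equality of coefficients *)

Section Chains.
Context {G : topgroupoid} {A : zmodType} {n : nat}.
Implicit Types c d : chain G A n.

Lemma chain_equiv_iso {I : Type} (s : seq I)
    (E E' : I -> bundle G (simplex n)) (a : I -> A) :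
  (forall i, List.In i s -> bundle_iso (E i) (E' i)) ->
  chain_equiv [seq (E i, a i) | i <- s] [seq (E' i, a i) | i <- s].
Proof.
move=> EE K pK; rewrite !big_map /=.
by apply: big_In => i /EE ii; exact: (bundle_iso_eql _ _ ii K).
Qed.

Lemma chain_equiv_trans c1 c2 c3 :
  chain_equiv c1 c2 -> chain_equiv c2 c3 -> chain_equiv c1 c3.
Proof. by move=> h1 h2 K pK; rewrite h1 ?h2. Qed.

Lemma chain_equiv_sym c1 c2 : chain_equiv c1 c2 -> chain_equiv c2 c1.
Proof. by move=> h K pK; rewrite h. Qed.

Lemma chain_equiv_add c1 c2 d1 d2 : chain_equiv c1 d1 -> chain_equiv c2 d2 ->
  chain_equiv (chain_add c1 c2) (chain_add d1 d2).
Proof. by move=> h1 h2 K pK; rewrite !big_cat /= h1 ?h2. Qed.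

Lemma chain_equiv_opp c d :
  chain_equiv c d -> chain_equiv (chain_opp c) (chain_opp d).
Proof. by move=> h K pK; rewrite !big_map !sumrN h. Qed.

Lemma chain_equiv_subr0 c : chain_equiv (chain_add c (chain_opp c)) [::].
Proof. by move=> K pK; rewrite big_cat /= big_map sumrN subrr big_nil. Qed.

Lemma chain_wf_add c d : chain_wf c -> chain_wf d -> chain_wf (chain_add c d).
Proof. by move=> wc wd p /List.in_app_iff [/wc|/wd]. Qed.

Lemma chain_wf_opp c : chain_wf c -> chain_wf (chain_opp c).
Proof. by move=> wc p /List.in_map_iff [q [<- /wc]]. Qed.

Lemma homologous_equiv c d : chain_equiv c d -> homologous c d.
Proof.
move=> cd; exists [::] => //; apply: chain_equiv_trans (chain_equiv_subr0 d).
exact: chain_equiv_add.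
Qed.

Lemma homologous_compat c c' d d' : chain_equiv c c' -> chain_equiv d d' ->
  homologous c d -> homologous c' d'.
Proof.
move=> cc dd [e we h]; exists e => //; apply: chain_equiv_trans h.
by apply/chain_equiv_sym/chain_equiv_add => //; exact: chain_equiv_opp.
Qed.

End Chains.

Lemma boundary_wf {G : topgroupoid} {A : zmodType} {m : nat}
  (c : chain G A m.+1) : chain_wf c -> chain_wf (boundary c).
Proof.
elim: c => [|p c IH] wc //.
apply: (chain_wf_add [seq (pullback (face i) p.1, sgn_coef i p.2)
  | i <- enum 'I_m.+2] (boundary c)); last first.
  by apply: IH => q qc; apply: wc; right.
move=> q /List.in_map_iff [i [<- _]] /=.
by apply: pullback_principal; [exact: face_cont|apply: wc; left].
Qed.

(** * The isomorphism on homology *)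

Section ChainMap.
Context {G H : topgroupoid}.
Context (T : forall n, bundle G (simplex n) -> bundle H (simplex n))
        (S : forall n, bundle H (simplex n) -> bundle G (simplex n)).
Context (mT : hs_map T) (mS : hs_map S).
Context (TS : hs_inverse T S) (ST : hs_inverse S T).
Context {A : zmodType}.

Definition chain_map {n : nat} (c : chain G A n) : chain H A n :=
  [seq (T n p.1, p.2) | p <- c].

Lemma chain_map_wf n (c : chain G A n) : chain_wf c -> chain_wf (chain_map c).
Proof.
by have [Tp _ _] := mT; move=> wc p /List.in_map_iff [q [<- /wc]]; exact: Tp.
Qed.

Lemma chain_map_add n (c d : chain G A n) :
  chain_map (chain_add c d) = chain_add (chain_map c) (chain_map d).
Proof. exact: map_cat. Qed.

Lemma chain_map_opp n (c : chain G A n) :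
  chain_map (chain_opp c) = chain_opp (chain_map c).
Proof. by rewrite /chain_map /chain_opp -!map_comp. Qed.

(** Identifies the coefficient of [chain_map c] at [B] with that of [c] at [S B], which is why
    [chain_map] respects [chain_equiv]. *)
Lemma hs_iso_adjoint n E B : is_principal E -> is_principal B ->
  `[< bundle_iso (T n E) B >] = `[< bundle_iso E (S n B) >].
Proof.
have [[Tp Ti _] [Sp Si _]] := (mT, mS); move=> pE pB.
apply/asboolP/asboolP => [h|h].
  apply: bundle_iso_trans (Si _ _ _ (Tp _ _ pE) pB h).
  by apply: bundle_iso_sym; exact: TS.
by apply: bundle_iso_trans (ST _ _ pB); apply: Ti => //; exact: Sp.
Qed.

Lemma chain_map_equiv n (c d : chain G A n) : chain_wf c -> chain_wf d ->
  chain_equiv c d -> chain_equiv (chain_map c) (chain_map d).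
Proof.
have [Sp _ _] := mS; move=> wc wd cd K pK; rewrite !big_map /=.
rewrite (big_In c _ (fun p => `[< bundle_iso p.1 (S n K) >])); last first.
  by move=> p /wc pp; exact: hs_iso_adjoint.
rewrite (big_In d _ (fun p => `[< bundle_iso p.1 (S n K) >])); last first.
  by move=> p /wd pp; exact: hs_iso_adjoint.
exact/cd/Sp.
Qed.

Lemma chain_map_boundary m (c : chain G A m.+1) : chain_wf c ->
  chain_equiv (chain_map (boundary c)) (boundary (chain_map c)).
Proof.
have [_ _ Tn] := mT; elim: c => [|p c IH] wc //.
rewrite /boundary /= chain_map_add; apply: chain_equiv_add; last first.
  by apply: IH => q qc; apply: wc; right.
rewrite /chain_map -map_comp; apply: chain_equiv_iso => i _ /=.
by apply: Tn; apply: wc; left.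
Qed.

Lemma chain_map_cycle n (c : chain G A n) :
  is_cycle c -> is_cycle (chain_map c).
Proof.
case: n c => [|n] c /=; first exact: chain_map_wf.
move=> [wc bc]; split; first exact: chain_map_wf.
apply: chain_equiv_trans (chain_equiv_sym _ _ (chain_map_boundary _ _ wc)) _.
by apply: (chain_map_equiv _ _ [::]) => //; exact: boundary_wf.
Qed.

Lemma chain_map_homologous n (c d : chain G A n) : chain_wf c -> chain_wf d ->
  homologous c d -> homologous (chain_map c) (chain_map d).
Proof.
move=> wc wd [e we h]; exists (chain_map e); first exact: chain_map_wf.
apply: chain_equiv_trans (chain_map_boundary _ _ we).
rewrite -chain_map_opp -chain_map_add; apply: chain_map_equiv => //.
  by apply: chain_wf_add => //; exact: chain_wf_opp.
exact: boundary_wf.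
Qed.

End ChainMap.

Lemma is_cycle_wf {G : topgroupoid} {A : zmodType} {n : nat}
  (c : chain G A n) : is_cycle c -> chain_wf c.
Proof. by case: n c => [//|n] c []. Qed.

Lemma chain_map_inverse {G H : topgroupoid}
    (T : forall n, bundle G (simplex n) -> bundle H (simplex n))
    (S : forall n, bundle H (simplex n) -> bundle G (simplex n))
    (A : zmodType) n (c : chain G A n) :
  hs_inverse T S -> chain_wf c ->
  chain_equiv (chain_map S (chain_map T c)) c.
Proof.
move=> TS wc; have cE : [seq (p.1, p.2) | p <- c] = c.
  by rewrite -[RHS]map_id; apply: eq_map => -[].
rewrite -[X in chain_equiv _ X]cE /chain_map -map_comp.
apply: (chain_equiv_iso c (fun p => S n (T n p.1)) fst snd) => p /wc.
exact: TS.
Qed.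

Lemma hs_equiv_homology G H A n : hs_equiv G H -> homology_iso G H A n.
Proof.
move=> [T [S [mT mS TS ST]]]; exists (chain_map T); split.
- by move=> c; exact: (chain_map_cycle T S).
- move=> c d /is_cycle_wf wc /is_cycle_wf wd; split.
    exact: (chain_map_homologous T S).
  (* Injectivity on classes: the homology is carried back by [S], and the round trip changes chains
     only up to [chain_equiv]. *)
  move=> h; apply: homologous_compat (chain_map_inverse T S A n c TS wc)
    (chain_map_inverse T S A n d TS wd) _.
  by apply: (chain_map_homologous S T) => //; exact: chain_map_wf.
- by move=> c d _ _; apply: homologous_equiv; rewrite chain_map_add.
move=> d cd; exists (chain_map S d); first exact: (chain_map_cycle S T).
by apply/homologous_equiv/chain_map_inverse => //; exact: is_cycle_wf.
Qed.

(** * The isomorphism on cohomology *)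

Section CochainMap.
Context {G H : topgroupoid}.
Context (S : forall n, bundle H (simplex n) -> bundle G (simplex n)).
Context (mS : hs_map S) {A : zmodType}.

(** Contravariance: cochains pass from [G] to [H] by precomposition with the map of bundles from [H]
    to [G]. *)
Definition cochain_map {n : nat} (phi : cochain G A n) : cochain H A n :=
  fun B => phi (S n B).

Lemma cochain_map_wf n (phi : cochain G A n) :
  cochain_wf phi -> cochain_wf (cochain_map phi).
Proof.
have [Sp Si _] := mS; move=> wphi E E' pE pE' EE.
by apply: wphi; [exact: Sp..|exact: Si].
Qed.

(** Faces commute with [S] only up to isomorphism, but [phi] is invariant under isomorphism, so the
    values agree exactly. *)
Lemma cochain_map_coboundary n (phi : cochain G A n) B :
  cochain_wf phi -> is_principal B ->
  coboundary (cochain_map phi) B = coboundary phi (S n.+1 B).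
Proof.
have [Sp _ Sn] := mS; move=> wphi pB; apply: eq_bigr => i _; congr sgn_coef.
apply: wphi; last exact: Sn.
  by apply/Sp/pullback_principal => //; exact: face_cont.
by apply: pullback_principal; [exact: face_cont|exact: Sp].
Qed.

Lemma cochain_map_cocycle n (phi : cochain G A n) :
  is_cocycle phi -> is_cocycle (cochain_map phi).
Proof.
have [Sp _ _] := mS; move=> [wphi cphi]; split; first exact: cochain_map_wf.
by move=> B pB; rewrite cochain_map_coboundary //; apply/cphi/Sp.
Qed.

Lemma cochain_map_cohomologous n (phi psi : cochain G A n) :
  cohomologous phi psi -> cohomologous (cochain_map phi) (cochain_map psi).
Proof.
have [Sp _ _] := mS; case: n phi psi => [|n] phi psi /=.
  by move=> h B pB; apply/h/Sp.
move=> [chi wchi h]; exists (cochain_map chi); first exact: cochain_map_wf.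
by move=> B pB; rewrite cochain_map_coboundary //; apply/h/Sp.
Qed.

End CochainMap.

Lemma cohomologous_eq {G : topgroupoid} {A : zmodType} n
    (phi psi : cochain G A n) :
  (forall E, is_principal E -> phi E = psi E) -> cohomologous phi psi.
Proof.
case: n phi psi => [//|n] phi psi h; exists (fun=> 0) => // E pE.
rewrite h // subrr /coboundary big1 // => i _.
by rewrite /sgn_coef oppr0 if_same.
Qed.

Lemma cohomologous_compat {G : topgroupoid} {A : zmodType} n
    (phi psi phi' psi' : cochain G A n) :
  (forall E, is_principal E -> phi E = phi' E) ->
  (forall E, is_principal E -> psi E = psi' E) ->
  cohomologous phi psi -> cohomologous phi' psi'.
Proof.
case: n phi psi phi' psi' => [|n] phi psi phi' psi' e e' /=.
  by move=> h E pE; rewrite -e // -e' // h.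
move=> [chi wchi h]; exists chi => // E pE.
by rewrite -e // -e' // h.
Qed.

Lemma cochain_map_inverse {G H : topgroupoid}
    (T : forall n, bundle G (simplex n) -> bundle H (simplex n))
    (S : forall n, bundle H (simplex n) -> bundle G (simplex n))
    (A : zmodType) n (phi : cochain G A n) E :
  hs_map T -> hs_map S -> hs_inverse T S -> cochain_wf phi -> is_principal E ->
  cochain_map T (cochain_map S phi) E = phi E.
Proof.
move=> [Tp _ _] [Sp _ _] TS wphi pE; apply: wphi => //; last exact: TS.
exact/Sp/Tp.
Qed.

Lemma hs_equiv_cohomology G H A n : hs_equiv G H -> cohomology_iso G H A n.
Proof.
move=> [T [S [mT mS TS ST]]]; exists (cochain_map S); split.
- by move=> phi; exact: cochain_map_cocycle.
- move=> phi psi [wphi _] [wpsi _]; split.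
    exact: cochain_map_cohomologous.
  (* Carried back along [T], the cochains agree with [phi] and [psi] on principal bundles, which is
     all that [cohomologous] sees. *)
  move=> /(cochain_map_cohomologous T mT).
  by apply: cohomologous_compat => E pE; exact: cochain_map_inverse.
- by move=> phi psi _ _; exact: cohomologous_eq.
move=> psi cpsi; exists (cochain_map T psi); first exact: cochain_map_cocycle.
by apply: cohomologous_eq => B pB; apply: cochain_map_inverse => //; case: cpsi.
Qed.

Theorem theorem5p9 (G H : topgroupoid) :
  morita_equiv G H ->
  forall (A : zmodType) (n : nat),
    homology_iso G H A n /\ cohomology_iso G H A n.
Proof.
move=> /morita_hs_equiv GH A n.
by split; [exact: hs_equiv_homology|exact: hs_equiv_cohomology].
Qed.
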